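(* Let $H$ be a complex Hilbert space, let $f$ be an operator monotone function on $(0,\infty)$ and let $n$ be a positive integer. Then $\|f^{(n)}(\cdot)\|$ is quasi-convex on the positive definite operators, i.e. $$\|f^{(n)}((1-\nu)A+\nu B)\|\leq \max\{\|f^{(n)}(A)\|,\ \|f^{(n)}(B)\|\}$$ for all positive definite operators $A,B\in B(H)$ and all $0\leq\nu\leq 1$.
   Context: $B(H)$ is the algebra of bounded linear operators on $H$, $\|\cdot\|$ is the operator norm, and $Sp(A)$ is the spectrum of $A$. A positive definite operator means a bounded self-adjoint operator $A$ with $\langle Ax,x\rangle>0$ for all $x\ne 0$ and $Sp(A)\subseteq(0,\infty)$. For a continuous real function $g$ on $(0,\infty)$, $g(A)$ is defined by the continuous functional calculus. A continuous real function $f$ on an interval $I$ is operator monotone if $A\le B$ implies $f(A)\le f(B)$ for all bounded self-adjoint operators $A,B$ with spectra in $I$ (on any complex Hilbert space). Operator monotone functions on $(0,\infty)$ are infinitely differentiable; $f^{(n)}$ denotes the $n$th derivative of the scalar function $f$. *)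

(* Defs.v *)
From HB Require Import structures.
From mathcomp Require Import all_boot all_order all_algebra.
From mathcomp Require Import complex.
From mathcomp Require Import all_classical all_reals all_analysis.

Set Implicit Arguments.
Unset Strict Implicit.
Unset Printing Implicit Defensive.

Import Order.TTheory GRing.Theory Num.Theory.
Import numFieldNormedType.Exports.

Local Open Scope classical_set_scope.
Local Open Scope ring_scope.
Local Open Scope complex_scope.

Record hilbertSpace (R : realType) := HilbertSpace {
  hilbert_sort :> completeNormedModType R[i];
  inner : {dot hilbert_sort for Num.conj};
  innerE : forall x, `|x| ^+ 2 = inner x x
}.

(* An operator is a plain function satisfying [bounded_operator]; sums and
   scalar multiples are the pointwise ones of [H -> H]. *)
Section Operators.
Variables (R : realType) (H : hilbertSpace R).
Implicit Types (A B T : H -> H).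

Definition bounded_operator : set (H -> H) :=
  [set A | linear A /\ exists M : R, forall x, `|A x| <= M%:C * `|x|].

(* On a normed space over [R[i]] the norm is a nonnegative real element of
   [R[i]], whence the real part. *)
Definition opnorm A : R := sup [set complex.Re `|A x| | x in [set x | `|x| <= 1]].

Definition self_adjoint A : Prop :=
  forall x y, inner H (A x) y = inner H x (A y).

Definition spectrum A : set R[i] :=
  [set z | ~ exists2 S, bounded_operator S &
     cancel (A - z *: id) S /\ cancel S (A - z *: id)].

Definition spectrum_in A (D : set R) : Prop :=
  spectrum A `<=` [set t%:C | t in D].

(* In the order of [R[i]], [a <= b] says that [b - a] is real and
   nonnegative. *)
Definition loewner_le A B : Prop :=
  forall x, inner H (A x) x <= inner H (B x) x.

Definition positive_definite A : Prop :=
  [/\ bounded_operator A, self_adjoint A,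
      forall x, x != 0 -> 0 < inner H (A x) x &
      spectrum_in A `]0, +oo[].

Definition horner_op A (p : {poly R}) : H -> H :=
  \sum_(i < size p) (p`_i)%:C *: iter i A.

(* [T] is the value at [g] of the extension by continuity of the polynomial
   calculus [p |-> p(A)], from the real polynomials with the supremum norm on
   the spectrum of [A] to the continuous real functions on it. *)
Definition is_cfc A (g : R -> R) T : Prop :=
  bounded_operator T /\
  exists p : nat -> {poly R},
    {uniform [set t | spectrum A t%:C], (fun k => horner (p k)) @ \oo --> g} /\
    (fun k => opnorm (horner_op A (p k) - T)) @ \oo --> (0 : R).

(* Meant for [A] bounded self-adjoint and [g] continuous on its spectrum, when
   there is exactly one such [T]. *)
Definition cfc (g : R -> R) A : H -> H := xget 0 (is_cfc A g).

End Operators.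

Definition operator_monotone (R : realType) (I : interval R) (f : R -> R) :
    Prop :=
  {within [set` I], continuous f} /\
  forall (H : hilbertSpace R) (A B : H -> H),
    bounded_operator A -> self_adjoint A -> spectrum_in A [set` I] ->
    bounded_operator B -> self_adjoint B -> spectrum_in B [set` I] ->
    loewner_le A B -> loewner_le (cfc f A) (cfc f B).

(* Main.v *)
Require Import Defs.
From HB Require Import structures.
From mathcomp Require Import all_boot all_order all_algebra.
From mathcomp Require Import complex ring lra zify.
From mathcomp Require Import all_classical all_reals all_analysis.

Import Order.TTheory GRing.Theory Num.Theory.
Import numFieldNormedType.Exports.

Local Open Scope classical_set_scope.
Local Open Scope ring_scope.
Local Open Scope complex_scope.

Set Implicit Arguments.
Unset Strict Implicit.
Unset Printing Implicit Defensive.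

(** The statement follows from two facts. On $(0,+\infty)$ the function
   $|f^{(n)}|$ is nonincreasing; hence $\|f^{(n)}(A)\| = |f^{(n)}(a)|$ for a
   positive definite $A$ whose spectrum has least element $a$. If $b$ is that of
   $B$, the quadratic form of $(1-\nu)A + \nu B$ is at least $\min(a, b)$, so the
   norm on the left is at most $|f^{(n)}(\min(a, b))|$, which is the larger of
   $|f^{(n)}(a)|$ and $|f^{(n)}(b)|$.

   The first fact is the part of Loewner's theorem that is needed, and is obtained
   without the integral representation. For $2n$ positive nodes, the polynomials of
   degree less than $n$ carry an inner product which is at the same time a weighted
   sum over the nodes of even rank and one over the nodes of odd rank, because
   divided differences vanish on polynomials of low degree. Multiplication by the
   variable, reduced modulo one or the other node polynomial, gives two self-adjoint
   operators that differ by a nonnegative form of rank one, and operator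
   monotonicity applied to them reads: the divided difference of $f q^2$ at the $2n$
   nodes is nonnegative when $q$ has degree less than $n$
   ([operator_monotone_quadrature], [operator_monotone_divdiff_sqr]). Taking
   $q = 1$, or $q = X - z$ for a node $z$ that tends to infinity, yields the sign
   $(-1)^m$ for divided differences of $f$ at $m \geq 2$ nodes
   ([operator_monotone_alternating]). These signs alone make $f$ differentiable
   and pass to $-f'$ ([alternating_derivable], [alternating_derive1]), so by
   induction they hold for $(-1)^n f^{(n)}$; with one and two nodes they say that
   $|f^{(n)}|$ is nonincreasing.

   For the second fact, the least spectral value of a self-adjoint operator $A$ is
   the infimum of its quadratic form and an approximate eigenvalue
   ([approx_eigenvalue_min]). The norm of $p(A)$ is attained by $|p|$ at an
   approximate eigenvalue, found by splitting $p^2 - \|p(A)\|^2$ into linear factors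
   ([opnorm_horner_attained]); this bounds the functional calculus from above. For
   the lower bound $f^{(n)}(A)$ has to exist, hence $f^{(n)}$ has to be a uniform
   limit of polynomials on an interval containing the spectrum; by the sign conditions
   Newton interpolation at nodes to the right of it converges geometrically
   ([alternating_poly_approx]). *)

(** * Divided differences and Newton interpolation *)

Section DividedDifference.
Variable F : fieldType.
Implicit Types (f g : F -> F) (s t : seq F) (x y z : F) (p : {poly F}).

Definition divdiff f s : F :=
  \sum_(z <- s) f z / \prod_(w <- s | w != z) (z - w).

Lemma perm_divdiff f s t : perm_eq s t -> divdiff f s = divdiff f t.
Proof.
move=> st; rewrite /divdiff (perm_big _ st) /=.
by apply: eq_bigr => z _; rewrite (perm_big _ st).
Qed.

Lemma eq_divdiff f g s : {in s, f =1 g} -> divdiff f s = divdiff g s.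
Proof. by move=> fg; apply: eq_big_seq => z zs; rewrite fg. Qed.

Lemma divdiffB f g s : divdiff (fun z => f z - g z) s = divdiff f s - divdiff g s.
Proof.
by rewrite /divdiff -sumrB; apply: eq_bigr => z _; rewrite mulrBl.
Qed.

Lemma divdiffZ a f s : divdiff (fun z => a * f z) s = a * divdiff f s.
Proof. by rewrite /divdiff mulr_sumr; apply: eq_bigr => z _; rewrite mulrA. Qed.

Lemma divdiff1 f x : divdiff f [:: x] = f x.
Proof. by rewrite /divdiff big_seq1 big_cons eqxx /= big_nil invr1 mulr1. Qed.

Lemma divdiff_shift f d s :
  divdiff f [seq z + d | z <- s] = divdiff (fun z => f (z + d)) s.
Proof.
rewrite /divdiff big_map; apply: eq_bigr => z _; congr (_ / _).
rewrite big_map; apply: eq_big => w; first by rewrite (inj_eq (addIr d)).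
by rewrite opprD addrACA subrr addr0.
Qed.

(** A factor vanishing at a node removes that node. The recursion on the nodes,
   the values on polynomials and the signs for an odd number of nodes all come
   from this. *)
Lemma divdiff_mul_root f x s : x \notin s ->
  divdiff (fun z => (z - x) * f z) (x :: s) = divdiff f s.
Proof.
move=> xs; rewrite /divdiff big_cons subrr mul0r mul0r add0r.
apply: eq_big_seq => z zs.
have zx : z != x by apply: contraNneq xs => <-.
have nz : z - x != 0 by rewrite subr_eq0.
by rewrite big_cons eq_sym zx invfM mulrACA mulfV // mul1r.
Qed.

Lemma divdiff_rec f x y s : uniq [:: x, y & s] ->
  divdiff f [:: x, y & s] * (x - y) = divdiff f (x :: s) - divdiff f (y :: s).
Proof.
move=> /=; rewrite inE negb_or => /and3P[/andP[xy xs] ys us].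
have yxs : y \notin x :: s by rewrite inE eq_sym negb_or xy.
have xys : x \notin y :: s by rewrite inE negb_or xy.
rewrite -(divdiff_mul_root f yxs) -(divdiff_mul_root f xys).
have /perm_divdiff -> : perm_eq [:: y, x & s] [:: x, y & s].
  by apply/permP => a /=; rewrite addnCA.
rewrite -divdiffB mulrC -divdiffZ; apply: eq_divdiff => z _.
by rewrite -mulrBl; congr (_ * _); ring.
Qed.

Lemma divdiff_cst c s : uniq s ->
  divdiff (fun=> c) s = if size s == 1%N then c else 0.
Proof.
case: s => [|x s]; first by rewrite /divdiff big_nil.
elim: s x => [|y s IH] x; first by rewrite divdiff1.
move=> uxys; have /= /andP[] := uxys; rewrite inE negb_or => /andP[xy xs].
case/andP=> ys us.
apply: (mulIf (_ : x - y != 0)); first by rewrite subr_eq0.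
by rewrite divdiff_rec // !IH /= ?xs ?ys // subrr mul0r.
Qed.

Lemma divdiff_horner p s : uniq s -> (size p <= size s)%N ->
  divdiff (horner p) s = p`_(size s).-1.
Proof.
elim: s p => [|x s IH] p.
  by rewrite leqn0 size_poly_eq0 /divdiff big_nil => _ /eqP->; rewrite coef0.
move=> /= /andP[xs us] ps; set q := p %/ ('X - x%:P).
have pE : p = q * ('X - x%:P) + p.[x]%:P by rewrite {1}(divp_eq p ('X - x%:P)) modp_XsubC.
have qs : (size q <= size s)%N.
  by rewrite size_divp ?polyXsubC_eq0 // size_XsubC /= leq_subLR.
transitivity (divdiff (fun z => (z - x) * q.[z] - - p.[x]) (x :: s)).
  by apply: eq_divdiff => z _; rewrite {1}pE !hornerE; ring.
rewrite divdiffB divdiff_mul_root // IH // divdiff_cst /= ?xs // eqSS.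
rewrite [in RHS]pE coefD coefC mulrBr coefB coefMX coefMC /=.
have q0 : q`_(size s) = 0 by rewrite nth_default.
rewrite q0 mul0r subr0; case: (s) qs => [|y s'] /=; last by rewrite subr0 addr0.
by rewrite leqn0 size_poly_eq0 => /eqP->; rewrite coef0 sub0r opprK add0r.
Qed.

(** The head of the list is the node added last. *)
Fixpoint newton_interp f s : {poly F} :=
  if s is x :: s' then
    newton_interp f s' + divdiff f (x :: s') *: \prod_(u <- s') ('X - u%:P)
  else 0.

Lemma newton_interp_err f s z : uniq (z :: s) ->
  f z - (newton_interp f s).[z] = divdiff f (z :: s) * \prod_(u <- s) (z - u).
Proof.
elim: s => [|x s IH] /= uzs.
  by rewrite horner0 subr0 big_nil mulr1 divdiff1.
rewrite !hornerE opprD addrA IH; last first.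
  by case/and3P: uzs; rewrite inE negb_or /= => /andP[_ ->] _ ->.
have -> : (\prod_(u <- s) ('X - u%:P)).[z] = \prod_(u <- s) (z - u).
  by rewrite horner_prod; apply: eq_bigr => u _; rewrite !hornerE.
by rewrite -mulrBl -divdiff_rec // big_cons mulrA.
Qed.

Lemma newton_interpE f s z : uniq s -> z \in s -> (newton_interp f s).[z] = f z.
Proof.
elim: s => [//|x s IH] /= /andP[xs us]; rewrite inE !hornerE.
have prodE : (\prod_(u <- s) ('X - u%:P)).[z] = \prod_(u <- s) (z - u).
  by rewrite horner_prod; apply: eq_bigr => u _; rewrite !hornerE.
rewrite prodE => /orP[/eqP->|zs].
  by rewrite -newton_interp_err /= ?xs // addrC subrK.
rewrite IH // [X in _ * X](_ : _ = 0) ?mulr0 ?addr0 //.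
by apply/eqP; rewrite prodf_seq_eq0; apply/hasP; exists z; rewrite ?subrr /=.
Qed.

Lemma size_newton_interp f s : (size (newton_interp f s) <= size s)%N.
Proof.
elim: s => [|x s IH] /=; first by rewrite size_poly0.
rewrite (leq_trans (size_polyD _ _)) // geq_max (leq_trans IH) //=.
by rewrite (leq_trans (size_scale_leq _ _)) // size_prod_XsubC.
Qed.

End DividedDifference.

(** * Functions whose divided differences alternate in sign *)

Section AlternatingDividedDifferences.
Variable R : realType.
Implicit Types (f : R -> R) (s t : seq R) (x y z : R).

(** The condition bears on more than [c] nodes. It is complete monotonicity on
   $(0,+\infty)$ in a form that presupposes no derivative: of [- f] for [c = 0],
   of the derivative of [f] for [c = 1]. *)
Definition alternating (c : nat) f : Prop := forall s,
  uniq s -> all (> 0) s -> (c < size s)%N -> 0 <= (-1) ^+ size s * divdiff f s.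

(** The difference of two divided differences that have all nodes but one in
   common is a divided difference with one more node. *)
Lemma alternating_replace c f x y s : alternating c f ->
  uniq [:: x, y & s] -> all (> 0) [:: x, y & s] -> (c <= (size s).+1)%N ->
  y <= x -> (-1) ^+ size s * divdiff f (y :: s) <= (-1) ^+ size s * divdiff f (x :: s).
Proof.
move=> fc u p cs yx; rewrite -subr_ge0 -mulrBr -divdiff_rec // mulrA.
rewrite mulr_ge0 ?subr_ge0 //.
by have := fc _ u p cs; rewrite /= !exprS mulN1r mulN1r opprK.
Qed.

(** The nodes are moved one at a time; in the induction [t] holds those that
   stay in place or have been moved. *)
Lemma alternating_translate c f (d : R) s t : alternating c f -> 0 < d ->
  (c <= size s + size t)%N ->
  uniq (s ++ [seq z + d | z <- s] ++ t) -> all (> 0) (s ++ t) ->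
  0 <= (-1) ^+ (size s + size t).+1 *
       (divdiff f ([seq z + d | z <- s] ++ t) - divdiff f (s ++ t)).
Proof.
move=> fc d0; elim: s t => [|x s IH] t cst.
  by rewrite subrr mulr0.
set sd := [seq z + d | z <- s] => u p.
rewrite [map _ _]/= -/sd.
have /IH IHt : (c <= size s + size ((x + d)%R :: t))%N by rewrite /= addnS -addSn.
have E1 : perm_eq (s ++ sd ++ (x + d) :: t) (x + d :: s ++ sd ++ t).
  by apply/permP => a; rewrite /= !count_cat /=; lia.
have {}u : uniq (x :: x + d :: s ++ sd ++ t).
  move: u; rewrite [map _ _]/= -/sd (@perm_uniq _ _ (x :: x + d :: s ++ sd ++ t)) //.
  by apply/permP => a; rewrite /= !count_cat /= !count_cat; lia.
have /andP[x0 p'] : (0 < x) && all (> 0) (s ++ t) by [].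
have u1 : uniq (x + d :: s ++ sd ++ t) by case/andP: u.
have := IHt; rewrite (perm_uniq E1) u1 => /(_ isT).
rewrite all_cat /=; move: p'; rewrite all_cat => /andP[ps pt].
rewrite ps pt andbT addr_gt0 // => /(_ isT).
rewrite addnS -addSn => H1.
have E2 : perm_eq ((x + d :: sd) ++ t) (sd ++ x + d :: t).
  exact: (permEl (perm_catCA [:: x + d] sd t)).
have E3 : perm_eq (x + d :: s ++ t) (s ++ x + d :: t).
  exact: (permEl (perm_catCA [:: x + d] s t)).
rewrite (perm_divdiff _ E2).
rewrite -[X in X - _](subrK (divdiff f (s ++ x + d :: t))) -addrA mulrDr addr_ge0 //.
have uxst : uniq [:: x + d, x & s ++ t].
  rewrite (perm_uniq (permEl (perm_catCA [:: x + d] [:: x] (s ++ t)))).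
  apply: subseq_uniq u; rewrite /= !eqxx.
  by rewrite cat_subseq // suffix_subseq.
rewrite -(perm_divdiff _ E3) -divdiff_rec //.
have -> : x + d - x = d by ring.
rewrite mulrA mulr_ge0 ?(ltW d0) //; rewrite addSn -size_cat.
apply: (fc [:: x + d, x & s ++ t]) => //.
  by rewrite /= addr_gt0 // x0 all_cat ps.
by rewrite /= size_cat ltnS -addSn.
Qed.

Lemma divdiff2 f x y : y != x -> divdiff f [:: y; x] = (f y - f x) / (y - x).
Proof.
move=> yx; have yx0 : y - x != 0 by rewrite subr_eq0.
apply: (mulIf yx0); rewrite divdiff_rec ?divdiff1 ?mulfVK //.
by rewrite /= inE yx.
Qed.

(** The difference of two slopes at [x] is a divided difference with three nodes
   times the distance. Those are nonpositive and, by the sign condition for four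
   nodes, increase with each node; so the value at three nodes to the left of
   $x/2$ bounds them from below. *)
Lemma alternating_slope_lipschitz f x : alternating 1 f -> 0 < x ->
  exists2 C, 0 <= C & forall y w, x / 2 < y -> x / 2 < w -> y != x -> w != x ->
    `|(f y - f x) / (y - x) - (f w - f x) / (w - x)| <= C * `|y - w|.
Proof.
move=> fa x0; set nodes := [:: x / 3; x / 4; x / 5].
exists (- divdiff f nodes).
  have := fa nodes; rewrite /= !exprS mulN1r mulN1r mulN1r expr0 opprK mulN1r.
  apply => //; last by rewrite !divr_gt0.
  rewrite !inE !negb_or; apply/and3P; split=> //; last by lra.
  by apply/andP; split; lra.
move=> y w xy xw yx wx; have [->|yw] := eqVneq y w.
  by rewrite !subrr normr0 mulr0.
rewrite -!divdiff2 // -divdiff_rec; last first.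
  by rewrite /= !inE negb_or yw yx wx.
rewrite normrM ler_wpM2r //.
have u3 : uniq [:: y; w; x] by rewrite /= !inE negb_or yw yx wx.
have D3 : divdiff f [:: y; w; x] <= 0.
  have := fa _ u3; rewrite /= !exprS mulN1r mulN1r mulN1r expr0 opprK mulN1r.
  by rewrite oppr_ge0; apply => //; rewrite x0 !andbT; apply/andP; split; lra.
rewrite ler0_norm // lerN2.
have rep a b c d : 0 < a -> a < b -> uniq [:: b; a; c; d] -> 0 < c -> 0 < d ->
    divdiff f [:: a; c; d] <= divdiff f [:: b; c; d].
  move=> a0 ab u c0 d0.
  have := @alternating_replace 1 f b a [:: c; d] fa u.
  rewrite /= sqrrN expr1n !mul1r a0 c0 d0 (lt_trans a0 ab).
  by apply => //; rewrite ltW.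
have rot1 a b c : divdiff f [:: a; b; c] = divdiff f [:: b; c; a].
  by apply: perm_divdiff; rewrite -(perm_rot 1).
have [h1 h2 h3] : [/\ x / 5 < x / 4, x / 4 < x / 3 & x / 3 < x / 2] by split; lra.
have h0 : 0 < x / 5 by lra.
have h4 : x / 2 < x by lra.
rewrite /nodes.
apply: (@le_trans _ _ (divdiff f [:: x; x / 4; x / 5])).
  apply: rep => //=; try lra.
  by rewrite !inE !negb_or ?[x == _]eq_sym ?yx ?wx ?yw /= ?andbT; repeat (apply/andP; split); lra.
rewrite rot1; apply: (@le_trans _ _ (divdiff f [:: y; x / 5; x])).
  apply: rep => //=; try lra.
  by rewrite !inE !negb_or ?yx ?andbT /=; repeat (apply/andP; split); lra.
rewrite rot1 [leRHS]rot1; apply: rep => //=; try lra.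
rewrite !inE !negb_or wx [w == y]eq_sym yw [x == y]eq_sym yx ?andbT /=.
by repeat (apply/andP; split); lra.
Qed.

Lemma alternating_cvg_slope f x : alternating 1 f -> 0 < x ->
  cvg (h^-1 *: (f (h + x) - f x) @[h --> 0^']).
Proof.
move=> fa x0; have [C C0 slopeC] := alternating_slope_lipschitz fa x0.
apply/cauchy_cvgP/cauchy_exP => e e0.
(* Points within [d] of [x] stay beyond $x/2$, and their slopes differ by at
   most $2 C d < e$. *)
pose d := Num.min (x / 2) (e / (C + 1)) / 2.
have C1 : 0 < C + 1 by lra.
have d0 : 0 < d by rewrite divr_gt0 // lt_min !divr_gt0.
have dx : 2 * d <= x / 2 by rewrite mulrC /d divfK // ge_min lexx.
have de : 2 * d <= e / (C + 1) by rewrite mulrC /d divfK // ge_min lexx orbT.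
exists (d^-1 *: (f (d + x) - f x)).
have slopeE h : h^-1 *: (f (h + x) - f x) = (f (h + x) - f x) / (h + x - x).
  by rewrite addrK /GRing.scale/= mulrC.
exists d => //= h; rewrite /ball_ /= sub0r normrN => hd h0.
rewrite -ball_normE /= !slopeE.
have /andP[hd1 hd2] : (- d < h) && (h < d) by rewrite -ltr_norml.
apply: (@le_lt_trans _ _ (C * (2 * d))).
  apply: (le_trans (slopeC _ _ _ _ _ _)); try lra.
  rewrite ler_wpM2l // opprD addrACA subrr addr0 ler_norml.
  by apply/andP; split; lra.
apply: (@le_lt_trans _ _ (C * (e / (C + 1)))); first by rewrite ler_wpM2l.
by rewrite mulrCA gtr_pMr // ltr_pdivrMr // mul1r; lra.
Qed.

Lemma alternating_derivable f x : alternating 1 f -> 0 < x -> derivable f x 1.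
Proof.
move=> fa x0; have := alternating_cvg_slope fa x0; rewrite /derivable.
set u := (fun h : R => _); set v := (fun h : R => _); suff -> : u = v by [].
by apply/funext => h; rewrite /u /v /= [h%:A]mulr1.
Qed.

Lemma seq_pos_lb s : exists2 e : R, 0 < e & {in s, forall d, 0 < d -> e <= d}.
Proof.
elim: s => [|d s [e e0 es]]; first by exists 1.
have [d0|d0] := ltP 0 d; last first.
  exists e => // c; rewrite inE => /orP[/eqP->|/es//].
  by rewrite ltNge d0.
exists (Num.min e d); first by rewrite lt_min e0.
by move=> c; rewrite inE => /orP[/eqP->|/es ec /ec]; rewrite ge_min ?lexx ?orbT // => ->.
Qed.

(** Divided differences of the difference quotients of [f] are, up to a factor,
   differences of divided differences of [f] at translated nodes; these are sums
   of divided differences of [f] with one more node. *)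
Lemma alternating_derive1 f : alternating 1 f -> alternating 0 (fun x => - f^`()%classic x).
Proof.
move=> fa s us ps s0.
pose q (h : R) := divdiff (fun x => h^-1 *: (f (h + x) - f x)) s.
have qcvg : q h @[h --> 0^'+] --> divdiff f^`()%classic s.
  rewrite /q /divdiff big_seq; under eq_cvg => h do rewrite big_seq.
  apply: cvg_big => [|x xs]; first exact: add_continuous.
  apply: cvgM; last exact: cvg_cst.
  apply: cvg_dnbhs_at_right.
  by apply: alternating_cvg_slope => //; exact: (allP ps).
(* Translation by less than [e] moves no node onto another. *)
have [e e0 es] := seq_pos_lb [seq x - y | x <- s, y <- s].
have qE h : q h = h^-1 * (divdiff f [seq z + h | z <- s] - divdiff f s).
  rewrite divdiff_shift -divdiffB -divdiffZ.
  by apply: eq_divdiff => z _; rewrite [h + z]addrC.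
have -> : (-1) ^+ size s * divdiff (fun x => - f^`()%classic x) s = (-1) ^+ (size s).+1 * divdiff f^`()%classic s.
  rewrite exprSr -mulrA -[in RHS]divdiffZ.
  by congr (_ * _); apply: eq_divdiff => z _; rewrite mulN1r.
have {qcvg} : (-1) ^+ (size s).+1 * q h @[h --> 0^'+] --> (-1) ^+ (size s).+1 * divdiff f^`()%classic s.
  by apply: cvgM qcvg; exact: cvg_cst.
move=> qcvg; rewrite -(cvg_lim _ qcvg) //; apply: limr_ge; first by apply/cvg_ex; eexists; exact: qcvg.
near=> h; rewrite qE mulrCA mulr_ge0 ?invr_ge0 //.
have h0 : 0 < h by near: h; exact: nbhs_right_gt.
have he : h < e by near: h; exact: nbhs_right_lt.
have := @alternating_translate 1 f h s [::] fa h0.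
rewrite !cats0 addn0; apply => //.
rewrite cat_uniq us map_inj_uniq ?us ?andbT; last exact: addIr.
apply/hasPn => _ /mapP[y ys ->]; apply/negP => /= yhs.
have /es : y + h - y \in [seq x - y | x <- s, y <- s] by apply/allpairsP; exists (y + h, y).
by rewrite [y + h]addrC addrK => /(_ h0); rewrite leNgt he.
Unshelve. all: by end_near. Qed.

Lemma alternating_weaken f : alternating 0 f -> alternating 1 f.
Proof. by move=> fa s u p s1; apply: fa => //; exact: ltnW. Qed.

(** Differentiating turns the condition for [c = 1] into the one for [c = 0] with
   the opposite sign, which is stronger; so the step can be repeated. *)
Lemma alternating_derive1n f n : alternating 1 f -> (0 < n)%N ->
  alternating 0 (fun x => (-1) ^+ n * f^`(n)%classic x).
Proof.
move=> fa; case: n => // n _; elim: n => [|n IH].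
  move=> s u p s0; have := alternating_derive1 fa u p s0.
  by rewrite (@eq_divdiff _ _ (fun x => (-1) ^+ 1 * f^`(1)%classic x)) // => z _; rewrite expr1 mulN1r.
have := alternating_derive1 (alternating_weaken IH).
move=> IH' s u p s0; have := IH' s u p s0.
rewrite (@eq_divdiff _ _ (fun x => (-1) ^+ n.+2 * f^`(n.+2)%classic x)) // => z zs.
rewrite [in RHS]derive1nS [in RHS]exprS mulN1r mulNr; congr (- _).
have z0 : 0 < z by exact: (allP p).
have sq1 : (-1 : R) ^+ n.+1 * (-1) ^+ n.+1 = 1 by rewrite -expr2 sqrr_sign.
have D := alternating_derivable (alternating_weaken IH) z0.
have fE : f^`(n.+1)%classic = (fun x => (-1) ^+ n.+1 * ((-1) ^+ n.+1 * f^`(n.+1)%classic x)).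
  by apply/funext => x; rewrite mulrA sq1 mul1r.
by rewrite [in RHS]fE [in RHS]derive1Ml // mulrA sq1 mul1r.
Qed.

Lemma alternating_le f x y : alternating 0 f -> 0 < x -> x <= y -> f x <= f y.
Proof.
move=> fa x0; rewrite le_eqVlt => /orP[/eqP->//|xy].
have u : uniq [:: y; x] by rewrite /= inE gt_eqF.
have := fa _ u; rewrite /= x0 (lt_trans x0 xy) sqrrN expr1n mul1r divdiff2 ?gt_eqF //.
move=> /(_ isT isT); rewrite pmulr_lge0 ?invr_gt0 ?subr_gt0 // subr_ge0 //.
Qed.

Lemma alternating_le0 f x : alternating 0 f -> 0 < x -> f x <= 0.
Proof.
move=> fa x0; have := fa [:: x]; rewrite /= x0 divdiff1 expr1 mulN1r oppr_ge0.
by apply.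
Qed.

Lemma alternating_norm_derive1n_le f n x y : alternating 1 f -> (0 < n)%N ->
  0 < x -> x <= y -> `|f^`(n)%classic y| <= `|f^`(n)%classic x|.
Proof.
move=> fa n0 x0 xy; have fn := alternating_derive1n fa n0.
have nE z : 0 < z -> `|f^`(n)%classic z| = - ((-1) ^+ n * f^`(n)%classic z).
  move=> z0; rewrite -ler0_norm ?(alternating_le0 fn z0) //.
  by rewrite normrM normrX normrN1 expr1n mul1r.
by rewrite !nE ?(lt_le_trans x0 xy) // lerN2; exact: (alternating_le fn x0 xy).
Qed.

End AlternatingDividedDifferences.

(** * Polynomial approximation of completely monotone functions *)

Section PolynomialApproximation.
Variable R : realType.
Implicit Types (g : R -> R) (s : seq R) (a b x y : R).

Lemma prod_sub_opp s y :
  \prod_(u <- s) (y - u) = (-1) ^+ size s * \prod_(u <- s) (u - y).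
Proof.
elim: s => [|u s IH]; first by rewrite !big_nil mulr1.
by rewrite !big_cons IH /= exprS; ring.
Qed.

(** To the left of the nodes every term of the Newton form has the sign of [g]. *)
Lemma newton_interp_le0 g s y : alternating 0 g -> uniq s -> all (> 0) s ->
  all (>= y) s -> (newton_interp g s).[y] <= 0.
Proof.
move=> ga; elim: s => [|x s IH] /=; first by rewrite horner0.
move=> /andP[xs us] /andP[x0 ps] /andP[yx ys].
rewrite !hornerE -oppr_ge0 opprD addr_ge0 ?oppr_ge0 ?IH //.
have -> : (\prod_(u <- s) ('X - u%:P)).[y] = (-1) ^+ size s * \prod_(u <- s) (u - y).
  by rewrite horner_prod -prod_sub_opp; apply: eq_bigr => u _; rewrite !hornerE.
rewrite -oppr_ge0 -mulNr mulrA mulr_ge0 //.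
  have := ga (x :: s); rewrite /= xs us x0 ps exprS mulN1r mulNr mulNr mulrC.
  by apply.
by rewrite big_seq prodr_ge0 // => u us'; rewrite subr_ge0; exact: (allP ys).
Qed.

(** The ratio $(u - x)/(u - y)$ is largest for $u = c$ and $x = a$. *)
Lemma prod_node_ratio s (a c x y : R) : y < a -> a <= x -> a < c ->
  all (>= x) s -> all (<= c) s ->
  \prod_(u <- s) (u - x) <= ((c - a) / (c - y)) ^+ size s * \prod_(u <- s) (u - y).
Proof.
move=> ya ax ac; elim: s => [|u s IH] /=; first by rewrite !big_nil expr0 mul1r.
move=> /andP[xu xs] /andP[uc cs]; rewrite !big_cons exprS mulrACA.
have cy : 0 < c - y by lra.
apply: ler_pM; rewrite ?IH //; first by lra.
  by rewrite big_seq prodr_ge0 // => v vs; rewrite subr_ge0; exact: (allP xs).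
rewrite mulrAC ler_pdivlMr //; nra.
Qed.

(** By the sign conditions the error divided by the node polynomial is monotone,
   so at $x$ it is controlled by the error at $y$; and that is at most $-g(y)$,
   because the interpolation polynomial has the sign of $g$ there. *)
Lemma newton_interp_err_le g s (a c x y : R) : alternating 0 g -> 0 < y ->
  y < a -> a <= x -> a < c -> uniq s -> all (> x) s -> all (<= c) s ->
  `|g x - (newton_interp g s).[x]| <= ((c - a) / (c - y)) ^+ size s * - g y.
Proof.
move=> ga y0 ya ax ac us xs cs.
have x0 : 0 < x by lra.
have ys : all (> y) s by apply: sub_all xs => u /=; lra.
have s0 : all (> 0) s by apply: sub_all xs => u /=; lra.
have nx : x \notin s by apply/negP => /(allP xs); rewrite ltxx.
have ny : y \notin s by apply/negP => /(allP ys); rewrite ltxx.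
have yx : y < x by lra.
have err z : z \notin s -> g z - (newton_interp g s).[z] =
    (-1) ^+ size s * divdiff g (z :: s) * \prod_(u <- s) (u - z).
  by move=> zs; rewrite newton_interp_err /= ?zs // prod_sub_opp; ring.
have sgn z : 0 < z -> z \notin s -> 0 <= - ((-1) ^+ size s * divdiff g (z :: s)).
  move=> z0 zs; have := ga (z :: s).
  by rewrite /= zs us z0 s0 exprS mulN1r mulNr; apply.
have prod_ge0 z : all (> z) s -> 0 <= \prod_(u <- s) (u - z).
  move=> zs; rewrite big_seq prodr_ge0 // => u us'.
  by rewrite subr_ge0 ltW //; exact: (allP zs).
rewrite ler0_norm; last first.
  by rewrite err // -oppr_ge0 -mulNr mulr_ge0 ?sgn ?prod_ge0.
rewrite err // -mulNr.
have rho0 : 0 <= (c - a) / (c - y) by rewrite divr_ge0; lra.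
apply: (@le_trans _ _ (- ((-1) ^+ size s * divdiff g (y :: s)) *
    (((c - a) / (c - y)) ^+ size s * \prod_(u <- s) (u - y)))).
  apply: ler_pM; rewrite ?sgn ?prod_ge0 //.
    rewrite lerN2; apply: (alternating_replace ga); rewrite ?ltW //=.
      by rewrite inE negb_or nx ny us gt_eqF.
    by rewrite x0 y0.
  by apply: prod_node_ratio => //; apply: sub_all xs => u /=; lra.
rewrite mulrCA ler_wpM2l ?exprn_ge0 // mulNr -err // lerN2 lerBrDr gerDl.
by apply: newton_interp_le0 => //; apply: sub_all ys => u /=; lra.
Qed.

Lemma alternating_poly_approx g a b : alternating 0 g -> 0 < a ->
  exists p : nat -> {poly R}, forall e : R, 0 < e -> exists N, forall k x,
    (N <= k)%N -> a <= x -> x <= b -> `|g x - (p k).[x]| < e.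
Proof.
move=> ga a0; have [ab|ba] := leP a b; last first.
  by exists (fun=> 0) => e e0; exists 0 => k x _ ax xb; have := lt_le_trans ba (le_trans ax xb); rewrite ltxx.
pose c := b + 1; pose y := a / 2; pose rho := (c - a) / (c - y).
have [y0 ya ac] : [/\ 0 < y, y < a & a < c] by rewrite /y /c; split; lra.
have cy : 0 < c - y by lra.
have rho0 : 0 < rho by rewrite divr_gt0; lra.
have rho1 : rho < 1 by rewrite ltr_pdivrMr // mul1r; lra.
(* Distinct nodes in $]b, c]$. *)
pose s k := [seq b + i.+1%:R^-1 | i <- iota 0 k] : seq R.
have us k : uniq (s k).
  rewrite map_inj_uniq ?iota_uniq // => i j /addrI/invr_inj/eqP.
  by rewrite eqr_nat eqSS => /eqP.
have cs k : all (<= c) (s k).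
  by apply/allP => _ /mapP[i _ ->]; rewrite /= /c lerD2l invf_le1 // ler1n.
have xs k x : x <= b -> all (> x) (s k).
  move=> xb; apply/allP => _ /mapP[i _ ->] /=; apply: (le_lt_trans xb).
  by rewrite ltrDl invr_gt0.
exists (fun k => newton_interp g (s k)) => e e0.
have gy0 : 0 <= - g y by rewrite oppr_ge0 (alternating_le0 ga).
have : rho ^+ k * - g y @[k --> \oo] --> 0 * - g y.
  by apply: cvgM; [apply: cvg_expr; rewrite gtr0_norm|exact: cvg_cst].
rewrite mul0r => /cvgrPdist_lt/(_ e e0)[N _ NE].
exists N => k x /NE /= ke ax xb; apply: le_lt_trans ke.
rewrite sub0r normrN (@ger0_norm _ (_ * _)) ?mulr_ge0 ?exprn_ge0 ?(ltW rho0) //.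
have := newton_interp_err_le ga y0 ya ax ac (us k) (xs k x xb) (cs k).
by rewrite size_map size_iota.
Qed.

End PolynomialApproximation.

(** * The real structure of a complex Hilbert space *)

Section RealHilbert.
Variables (R : realType) (H : hilbertSpace R).
Implicit Types (x y : H) (a c : R) (z : R[i]) (A : H -> H).

(** The norm and the inner product take complex values. For self-adjoint operators
   nearly all arguments can be carried out in the underlying real Hilbert
   space. *)
Definition rnorm x : R := complex.Re `|x|.
Definition rinner x y : R := complex.Re (inner H x y).

Lemma Re_conj z : complex.Re (Num.conj z) = complex.Re z.
Proof. by case: z. Qed.

Lemma Re_realM a z : complex.Re (a%:C * z) = a * complex.Re z.
Proof. by case: z => u v /=; rewrite mul0r subr0. Qed.

Lemma conj_real a : Num.conj (a%:C : R[i]) = a%:C.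
Proof. by apply/eqP; rewrite eq_complex /= oppr0 !eqxx. Qed.

Lemma normE x : `|x| = (rnorm x)%:C.
Proof. by rewrite /rnorm RRe_real //; apply: ger0_real; exact: normr_ge0. Qed.

Lemma rnorm_ge0 x : 0 <= rnorm x.
Proof. by rewrite -(lecR 0) -normE; exact: normr_ge0. Qed.

Lemma rnormD x y : rnorm (x + y) <= rnorm x + rnorm y.
Proof. by rewrite -lecR rmorphD /= -!normE; exact: ler_normD. Qed.

Lemma rnormZ z x : rnorm (z *: x) = complex.Re `|z| * rnorm x.
Proof.
by rewrite /rnorm normrZ normE [in LHS]/rnorm -[`|z|]RRe_real ?ger0_real //= mul0r subr0.
Qed.

Lemma rnormZr a x : rnorm (a%:C *: x) = `|a| * rnorm x.
Proof. by rewrite rnormZ normc_def /= expr0n addr0 sqrtr_sqr. Qed.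

Lemma rnorm0 : rnorm 0 = 0. Proof. by rewrite /rnorm normr0. Qed.

Lemma rnormN x : rnorm (- x) = rnorm x. Proof. by rewrite /rnorm normrN. Qed.

Lemma rnormB x y : rnorm (x - y) = rnorm (y - x).
Proof. by rewrite -rnormN opprB. Qed.

Lemma rnorm_eq0 x : rnorm x = 0 -> x = 0.
Proof. by move=> x0; apply/eqP; rewrite -normr_eq0 normE x0. Qed.

Lemma rnorm_lt_gt0 c x y : rnorm y < c * rnorm x -> 0 < rnorm x.
Proof.
move=> xy; rewrite lt0r rnorm_ge0 andbT; apply: contraTneq xy => ->.
by rewrite mulr0 -leNgt rnorm_ge0.
Qed.

Lemma rnorm_dist x y w : rnorm (x - w) <= rnorm (x - y) + rnorm (y - w).
Proof. by apply: le_trans (rnormD _ _); rewrite addrA subrK. Qed.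

Lemma rinnerC x y : rinner x y = rinner y x.
Proof.
by rewrite /rinner hermC expr0 mul1r; exact: Re_conj.
Qed.

Lemma rinnerDl x y w : rinner (x + y) w = rinner x w + rinner y w.
Proof. by rewrite /rinner linearDl; exact: (raddfD (@complex.Re R : Rcomplex R -> R)). Qed.

Lemma rinnerDr x y w : rinner w (x + y) = rinner w x + rinner w y.
Proof. by rewrite rinnerC rinnerDl !(rinnerC w). Qed.

Lemma rinnerZl a x w : rinner (a%:C *: x) w = a * rinner x w.
Proof.
by rewrite /rinner linearZl_LR; exact: Re_realM.
Qed.

Lemma rinnerZr a x w : rinner w (a%:C *: x) = a * rinner w x.
Proof. by rewrite rinnerC rinnerZl rinnerC. Qed.

Lemma rinnerNl x w : rinner (- x) w = - rinner x w.
Proof. by rewrite /rinner linearNl; exact: (raddfN (@complex.Re R : Rcomplex R -> R)). Qed.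

Lemma rinnerNr x w : rinner w (- x) = - rinner w x.
Proof. by rewrite rinnerC rinnerNl rinnerC. Qed.

Definition rinnerE := (rinnerDl, rinnerDr, rinnerNl, rinnerNr, rinnerZl, rinnerZr).

Lemma rnorm_sqr x : rnorm x ^+ 2 = rinner x x.
Proof. by rewrite /rinner -innerE normE -rmorphXn. Qed.

Lemma rinner_ge0 x : 0 <= rinner x x.
Proof. by rewrite -rnorm_sqr exprn_ge0 // rnorm_ge0. Qed.

Lemma rinner_le x y : rinner x y <= rnorm x * rnorm y.
Proof.
have [n0|n0] := eqVneq (rnorm x * rnorm y) 0.
  move/eqP: n0; rewrite mulf_eq0 => /orP[] /eqP /rnorm_eq0 ->.
    by rewrite /rinner linear0l rnorm0 mul0r.
  by rewrite rinnerC /rinner linear0l rnorm0 mulr0.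
have := rinner_ge0 ((rnorm y)%:C *: x - (rnorm x)%:C *: y).
rewrite !rinnerE -!rnorm_sqr (rinnerC y x) => h.
have n1 : 0 < rnorm x * rnorm y by rewrite lt0r n0 mulr_ge0 ?rnorm_ge0.
rewrite -(ler_pM2l n1); nra.
Qed.

Lemma rinner_norm_le x y : `|rinner x y| <= rnorm x * rnorm y.
Proof.
by rewrite ler_norml rinner_le andbT lerNl -rinnerNl -(rnormN x) rinner_le.
Qed.

Lemma inner_self_real x : inner H x x = (rnorm x ^+ 2)%:C.
Proof. by rewrite -innerE normE rmorphXn. Qed.

Lemma bounded_linear A : bounded_operator A -> linear A. Proof. by case. Qed.

Lemma linear_funD A x y : linear A -> A (x + y) = A x + A y.
Proof. by move=> Al; have := Al 1 x y; rewrite !scale1r. Qed.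

Lemma linear_fun0 A : linear A -> A 0 = 0.
Proof. by move=> Al; apply: (addrI (A 0)); rewrite -linear_funD // !addr0. Qed.

Lemma linear_funZ A z x : linear A -> A (z *: x) = z *: A x.
Proof. by move=> Al; have := Al z x 0; rewrite addr0 linear_fun0 // addr0. Qed.

Lemma linear_funN A x : linear A -> A (- x) = - A x.
Proof. by move=> Al; rewrite -scaleN1r linear_funZ // scaleN1r. Qed.

Lemma linear_funB A x y : linear A -> A (x - y) = A x - A y.
Proof. by move=> Al; rewrite linear_funD // linear_funN. Qed.

Lemma bounded_rnorm A : bounded_operator A ->
  exists2 M, 0 < M & forall x, rnorm (A x) <= M * rnorm x.
Proof.
move=> [_ [M AM]]; exists (`|M| + 1) => [|x]; first by rewrite ltr_wpDl.
have := AM x; rewrite !normE -rmorphM lecR => /le_trans; apply.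
by rewrite ler_wpM2r ?rnorm_ge0 //; apply: (le_trans (ler_norm M)); rewrite lerDl.
Qed.

Lemma bounded_operatorP A M : linear A -> (forall x, rnorm (A x) <= M * rnorm x) ->
  bounded_operator A.
Proof.
by move=> Al AM; split=> //; exists M => x; rewrite !normE -rmorphM lecR.
Qed.

Lemma opnorm_le A c : 0 <= c -> (forall x, rnorm (A x) <= c * rnorm x) ->
  opnorm A <= c.
Proof.
move=> c0 Ac; apply: ge_sup; first by exists (rnorm (A 0)), 0; rewrite //= normr0 ler01.
move=> _ [x /= x1 <-]; apply: (le_trans (Ac x)).
by move: x1; rewrite normE -[1](rmorph1 (real_complex R)) lecR => x1; rewrite ler_piMr.
Qed.

Lemma opnorm_ub A x : bounded_operator A -> rnorm (A x) <= opnorm A * rnorm x.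
Proof.
move=> Ab; have [M M0 AM] := bounded_rnorm Ab; have Al := bounded_linear Ab.
have [x0|x0] := eqVneq (rnorm x) 0.
  by rewrite (rnorm_eq0 x0) linear_fun0 // rnorm0 mulr0.
have xp : 0 < rnorm x by rewrite lt0r x0 rnorm_ge0.
rewrite -ler_pdivrMr // mulrC.
have -> : (rnorm x)^-1 * rnorm (A x) = rnorm (A ((rnorm x)^-1%:C *: x)).
  by rewrite linear_funZ // rnormZr ger0_norm // invr_ge0 ltW.
apply: ub_le_sup; last first.
  exists ((rnorm x)^-1%:C *: x) => //=.
  rewrite normE rnormZr ger0_norm ?invr_ge0 ?(ltW xp) // mulVf //; exact: lexx.
exists M; apply/ubP => _ [y /= y1 <-]; apply: (le_trans (AM y)).
move: y1; rewrite normE -[1](rmorph1 (real_complex R)) lecR => y1.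
by rewrite ler_piMr // ltW.
Qed.

Lemma opnorm_ge0 A : 0 <= opnorm A.
Proof.
have [bA|nA] := pselect (has_sup [set complex.Re `|A x| | x in [set x | `|x| <= 1]]).
  apply: (@le_trans _ _ (rnorm (A 0))); first exact: rnorm_ge0.
  by apply: (ub_le_sup bA.2); exists 0; rewrite //= normr0 ler01.
by rewrite /opnorm sup_out.
Qed.

Lemma self_adjoint_rinner A x y : self_adjoint A -> rinner (A x) y = rinner x (A y).
Proof. by move=> As; rewrite /rinner As. Qed.

Lemma self_adjoint_Im A x : self_adjoint A -> complex.Im (inner H (A x) x) = 0.
Proof.
move=> As; have ImJ z : z = Num.conj z -> complex.Im z = 0.
  by case: z => b d [] /= /eqP; rewrite -addr_eq0 -mulr2n mulrn_eq0 /= => /eqP.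
by apply: ImJ; rewrite [LHS]As [LHS]hermC expr0 mul1r.
Qed.

Lemma cauchy_seq_lim (u : nat -> H) :
  (forall e : R, 0 < e -> exists N, forall m n, (N <= m)%N -> (N <= n)%N ->
     rnorm (u m - u n) < e) ->
  exists l, forall e : R, 0 < e -> exists N, forall n, (N <= n)%N -> rnorm (u n - l) < e.
Proof.
move=> uc; have : cvg (u @ \oo).
  apply/cauchy_cvgP/cauchy_exP => e e0.
  have eR : e = (complex.Re e)%:C by rewrite RRe_real // gtr0_real.
  have [N uN] := uc (complex.Re e) ltac:(by rewrite -(ltcR 0) -eR).
  exists (u N); exists N => // n Nn; rewrite -ball_normE /= normE eR ltcR.
  exact: uN.
case/cvg_ex => l /cvgrPdist_lt ul; exists l => e e0.
have [|N _ uN] := ul e%:C; first by rewrite (ltcR 0).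
by exists N => n /uN /=; rewrite normE ltcR rnormB.
Qed.

End RealHilbert.

(** * Polynomials of an operator *)

Section PolynomialCalculus.
Variables (R : realType) (H : hilbertSpace R).
Implicit Types (x y : H) (a c t : R) (z : R[i]) (A : H -> H) (p q : {poly R}) (P Q : {poly R[i]}).

(** Complex coefficients are allowed so that the polynomials can be split into
   linear factors. *)
Definition ceval A P x : H := \sum_(i < size P) P`_i *: iter i A x.

Lemma horner_opE A p x : horner_op A p x = ceval A (map_poly (real_complex R) p) x.
Proof.
rewrite /horner_op fct_sumE /ceval size_map_poly.
by apply: eq_bigr => i _; rewrite coef_map.
Qed.

Lemma ceval_widen n A P x : (size P <= n)%N ->
  ceval A P x = \sum_(i < n) P`_i *: iter i A x.
Proof.
move=> Pn; rewrite /ceval (big_ord_widen n (fun i => P`_i *: iter i A x)) //.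
rewrite big_mkcond /=; apply: eq_bigr => i _; case: ifP => // /negbT.
by rewrite -leqNgt => iP; rewrite nth_default // scale0r.
Qed.

Lemma cevalD A P Q x : ceval A (P + Q) x = ceval A P x + ceval A Q x.
Proof.
rewrite !(@ceval_widen (maxn (size P) (size Q))) ?leq_maxl ?leq_maxr ?size_polyD //.
by rewrite -big_split; apply: eq_bigr => i _; rewrite coefD scalerDl.
Qed.

Lemma cevalZ A z P x : ceval A (z *: P) x = z *: ceval A P x.
Proof.
rewrite (@ceval_widen (size P)) ?size_scale_leq // scaler_sumr.
by apply: eq_bigr => i _; rewrite coefZ scalerA.
Qed.

Lemma cevalC A z x : ceval A z%:P x = z *: x.
Proof.
by rewrite (@ceval_widen 1) ?size_polyC_leq1 // big_ord1 coefC.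
Qed.

Lemma cevalB A P Q x : ceval A (P - Q) x = ceval A P x - ceval A Q x.
Proof. by rewrite cevalD -scaleN1r cevalZ scaleN1r. Qed.

Lemma linear_sum A (I : Type) (r : seq I) (F : I -> H) : linear A ->
  A (\sum_(i <- r) F i) = \sum_(i <- r) A (F i).
Proof.
move=> Al; elim: r => [|i r IH]; first by rewrite !big_nil linear_fun0.
by rewrite !big_cons linear_funD // IH.
Qed.

Lemma cevalMX A P x : linear A -> ceval A (P * 'X) x = A (ceval A P x).
Proof.
move=> Al; rewrite (@ceval_widen (size P).+1); last first.
  by rewrite (leq_trans (size_polyMleq _ _)) // size_polyX addn2.
rewrite big_ord_recl coefMX /= scale0r add0r linear_sum //.
by apply: eq_bigr => i _; rewrite coefMX /= linear_funZ.
Qed.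

Lemma ceval_linear A P : linear A -> linear (ceval A P).
Proof.
move=> Al; elim/poly_ind: P => [|P z IH] w x y.
  by rewrite -[0]/(0%:P) !cevalC !scale0r scaler0 add0r.
rewrite !cevalD !cevalMX // !cevalC IH (linear_funD _ _ Al) (linear_funZ _ _ Al).
by rewrite !scalerDr !scalerA [z * w]mulrC addrACA.
Qed.

Lemma cevalM A P Q x : linear A -> ceval A (P * Q) x = ceval A P (ceval A Q x).
Proof.
move=> Al; elim/poly_ind: P => [|P z IH].
  by rewrite mul0r -[0]/(0%:P) !cevalC !scale0r.
rewrite mulrDl !cevalD -mulrA ['X * Q]mulrC mulrA !cevalMX // IH cevalC.
by rewrite mul_polyC cevalZ.
Qed.

Lemma ceval_XsubC A z x : linear A -> ceval A ('X - z%:P) x = A x - z *: x.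
Proof.
move=> Al; rewrite cevalB cevalC; congr (_ - _).
by rewrite -['X]mul1r -[1]/(1%:P) cevalMX // cevalC scale1r.
Qed.

Lemma ceval_bounded A P : bounded_operator A -> bounded_operator (ceval A P).
Proof.
move=> Ab; have Al := bounded_linear Ab.
have [M M0 AM] := bounded_rnorm Ab.
suff [K K0 PK] : exists2 K, 0 <= K & forall x, rnorm (ceval A P x) <= K * rnorm x.
  by apply: (bounded_operatorP (ceval_linear P Al) PK).
elim/poly_ind: P => [|P z [K K0 IH]].
  by exists 0 => // x; rewrite -[0]/(0%:P) cevalC scale0r rnorm0 mul0r.
exists (M * K + complex.Re `|z|).
  by rewrite addr_ge0 ?mulr_ge0 ?(ltW M0) // normc_def sqrtr_ge0.
move=> x; rewrite cevalD cevalMX // cevalC mulrDl; apply: (le_trans (rnormD _ _)).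
rewrite rnormZ lerD2r; apply: (le_trans (AM _)).
by rewrite -mulrA ler_wpM2l ?(ltW M0).
Qed.

Lemma horner_opM A p q x : linear A ->
  horner_op A (p * q) x = horner_op A p (horner_op A q x).
Proof. by move=> Al; rewrite !horner_opE rmorphM cevalM. Qed.

Lemma horner_opB A p q x :
  horner_op A (p - q) x = horner_op A p x - horner_op A q x.
Proof. by rewrite !horner_opE rmorphB cevalB. Qed.

Lemma horner_opC A a x : horner_op A a%:P x = a%:C *: x.
Proof. by rewrite horner_opE map_polyC cevalC. Qed.

Lemma horner_opX A x : linear A -> horner_op A 'X x = A x.
Proof.
by move=> Al; rewrite horner_opE map_polyX -['X]mul1r -[1]/(1%:P) cevalMX // cevalC scale1r.
Qed.

Lemma horner_op_linear A p : linear A -> linear (horner_op A p).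
Proof. by move=> Al w x y; rewrite !horner_opE ceval_linear. Qed.

Lemma horner_op_bounded A p : bounded_operator A -> bounded_operator (horner_op A p).
Proof.
move=> Ab; have := ceval_bounded (map_poly (real_complex R) p) Ab.
by congr bounded_operator; apply/funext => x; rewrite horner_opE.
Qed.

Lemma horner_op_self_adjoint A p : linear A -> self_adjoint A ->
  self_adjoint (horner_op A p).
Proof.
move=> Al As; elim/poly_ind: p => [|p a IH] x y.
  by rewrite -[0]/(0%:P) !horner_opC !scale0r linear0l linear0r.
have E u : horner_op A (p * 'X + a%:P) u = A (horner_op A p u) + a%:C *: u.
  by rewrite !horner_opE rmorphD rmorphM /= map_polyX map_polyC cevalD cevalMX // cevalC.
have comm u : A (horner_op A p u) = horner_op A p (A u).
  by rewrite -[in LHS](horner_opX (horner_op A p u) Al) -[in RHS](horner_opX u Al) -!horner_opM // mulrC.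
rewrite !E linearDl linearDr; congr (_ + _).
  by rewrite [in RHS]comm; apply: etrans (IH _ _); exact: As.
rewrite linearZl_LR linearZr_LR; congr (_ * _).
exact/esym/conj_real.
Qed.

Lemma horner_op_XsubC A a x : linear A ->
  horner_op A ('X - a%:P) x = A x - a%:C *: x.
Proof. by move=> Al; rewrite horner_opB horner_opX // horner_opC. Qed.

End PolynomialCalculus.

(** * Approximate eigenvalues of self-adjoint operators *)

Section ApproximateSpectrum.
Variables (R : realType) (H : hilbertSpace R).
Implicit Types (x y : H) (a b c t e : R) (z : R[i]) (A : H -> H) (p q : {poly R}) (P Q : {poly R[i]}).

(** Homogeneous in [x], so that no vector needs to be normalised and the negation
   says that [A - z] is bounded below. *)
Definition approx_eigenvalue A z : Prop :=
  forall e, 0 < e -> exists x, rnorm (A x - z *: x) < e * rnorm x.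

Lemma not_approx_eigenvalue A z : ~ approx_eigenvalue A z ->
  exists2 e, 0 < e & forall x, e * rnorm x <= rnorm (A x - z *: x).
Proof.
move=> /existsNP[e /not_implyP[e0 Ae]]; exists e => // x.
by rewrite leNgt; apply/negP => xe; apply: Ae; exists x.
Qed.

Lemma approx_eigenvalue_spectrum A z : approx_eigenvalue A z -> spectrum A z.
Proof.
move=> Az [S Sb [AS _]]; have [M M0 SM] := bounded_rnorm Sb.
have [x xM] := Az M^-1 ltac:(by rewrite invr_gt0).
have := SM ((A - z *: id) x); rewrite AS leNgt => /negP; apply.
by rewrite mulrC -ltr_pdivlMr // mulrC.
Qed.

Lemma Im_inner_le x y : `|complex.Im (inner H x y)| <= rnorm x * rnorm y.
Proof.
have Rei z : complex.Re ('i%C * z) = - complex.Im z by rewrite mulrC ReiNIm.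
have -> : complex.Im (inner H x y) = - rinner ('i%C *: x) y.
  by rewrite /rinner linearZl_LR; have /= -> := Rei (inner H x y); rewrite opprK.
rewrite normrN; apply: (le_trans (rinner_norm_le _ _)).
by rewrite rnormZ normc_def /= expr0n expr1n add0r sqrtr1 mul1r.
Qed.

(** The imaginary part of [inner H (A x - z *: x) x] is minus that of [z] times
   the square of the norm of [x], and it is at most the product of the norms. *)
Lemma approx_eigenvalue_real A z : self_adjoint A -> approx_eigenvalue A z ->
  z = (complex.Re z)%:C.
Proof.
move=> As Az; suff z0 : complex.Im z = 0.
  by move: z0; clear; case: z => u v /= ->.
apply/eqP/negPn/negP => z0.
have [x xz] := Az `|complex.Im z| ltac:(by rewrite normr_gt0).
have x0 := rnorm_lt_gt0 xz.
have := Im_inner_le (A x - z *: x) x; rewrite leNgt => /negP; apply.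
have ImB u v (r : R) : complex.Im u = 0 -> complex.Im (u - v * r%:C) = - (complex.Im v * r).
  by case: u v => ? ? [? ?] /= ->; rewrite mulr0 !add0r.
have E : complex.Im (inner H (A x - z *: x) x) = - (complex.Im z * rnorm x ^+ 2).
  rewrite linearBl linearZl_LR [X in _ - _ X]inner_self_real; apply: ImB.
  exact: self_adjoint_Im.
by rewrite E normrN normrM [`|_ ^+ 2|]ger0_norm ?exprn_ge0 ?rnorm_ge0 // expr2 mulrA ltr_pM2r.
Qed.

(** Otherwise every factor [A - z] of the split polynomial is bounded below, and
   with them their product. *)
Lemma approx_eigenvalue_root A P : linear A -> P != 0 ->
  (forall e, 0 < e -> exists x, rnorm (ceval A P x) < e * rnorm x) ->
  exists2 z, root P z & approx_eigenvalue A z.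
Proof.
move=> Al P0 Pe; have [r Pr] := closed_field_poly_normal P.
have lP : 0 < complex.Re `|lead_coef P|.
  by rewrite -ltcR RRe_real ?normr_real // normr_gt0 lead_coef_eq0.
apply: contrapT => nz.
have {}nz z : z \in r -> ~ approx_eigenvalue A z.
  by move=> zr Az; apply: nz; exists z => //; rewrite Pr rootZ ?lead_coef_eq0 // root_prod_XsubC.
have [e e0 er] : exists2 e, 0 < e & forall x,
    e * rnorm x <= rnorm (ceval A (\prod_(z <- r) ('X - z%:P)) x).
  elim: r {Pr} nz => [_|z r IH nz].
    by exists 1 => // x; rewrite big_nil -polyC1 cevalC scale1r mul1r.
  have [|e e0 er] := IH; first by move=> w wr; apply: nz; rewrite inE wr orbT.
  have [d d0 dz] := not_approx_eigenvalue (nz z ltac:(by rewrite inE eqxx)).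
  exists (d * e) => [|x]; first by rewrite mulr_gt0.
  rewrite big_cons cevalM // ceval_XsubC //; apply: le_trans (dz _).
  by rewrite -mulrA ler_wpM2l // ltW.
have [x] := Pe (complex.Re `|lead_coef P| * e) ltac:(by rewrite mulr_gt0).
rewrite {1}Pr cevalZ rnormZ -mulrA ltr_pM2l // ltNge => /negP; apply.
exact: er.
Qed.

(** From the nonnegativity of the form of [K] at $x - N^{-1} K x$. *)
Lemma psd_rnorm_le K N x : linear K -> self_adjoint K ->
  (forall y, 0 <= rinner (K y) y) -> 0 < N ->
  (forall y, rinner (K y) y <= N * rnorm y ^+ 2) ->
  rnorm (K x) ^+ 2 <= N * rinner (K x) x.
Proof.
move=> Kl Ks K0 N0 KN.
have := K0 (x - (N^-1)%:C *: K x).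
rewrite (linear_funB _ _ Kl) (linear_funZ _ _ Kl) !rinnerE.
rewrite (self_adjoint_rinner (K x) x Ks) -rnorm_sqr => h.
have h2 := KN (K x).
rewrite -(ler_pM2l (_ : 0 < N^-1)) ?invr_gt0 // mulKf ?gt_eqF //.
have h3 : N^-1 * (N^-1 * rinner (K (K x)) (K x)) <= N^-1 * rnorm (K x) ^+ 2.
  by rewrite ler_wpM2l ?invr_ge0 ?(ltW N0) // -ler_pdivlMl ?invr_gt0 // invrK.
lra.
Qed.

(** The number is the infimum $m$ of the quadratic form on the unit sphere: as
   the form of [A - m] is nonnegative, vectors on which it is small are almost
   mapped to zero. *)
Lemma approx_eigenvalue_min A : bounded_operator A -> self_adjoint A ->
  (exists x : H, rnorm x != 0) ->
  exists m, approx_eigenvalue A m%:C /\ forall x, m * rnorm x ^+ 2 <= rinner (A x) x.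
Proof.
move=> Ab As [x0 x00]; have Al := bounded_linear Ab.
have [M M0 AM] := bounded_rnorm Ab.
have AM2 x : `|rinner (A x) x| <= M * rnorm x ^+ 2.
  apply: (le_trans (rinner_norm_le _ _)).
  by rewrite expr2 mulrA ler_wpM2r ?rnorm_ge0.
pose E := [set rinner (A x) x | x in [set x | rnorm x = 1]].
have unit x : rnorm x != 0 -> rnorm ((rnorm x)^-1%:C *: x) = 1.
  by move=> nx; rewrite rnormZr ger0_norm ?invr_ge0 ?rnorm_ge0 // mulVf.
have Ei : has_inf E.
  split; first by eexists; exists ((rnorm x0)^-1%:C *: x0); [exact: unit|].
  exists (- M) => _ [x /= x1 <-].
  by have := AM2 x; rewrite x1 expr1n mulr1 ler_norml => /andP[].
exists (inf E); set m := inf E.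
have mA x : m * rnorm x ^+ 2 <= rinner (A x) x.
  have [nx|nx] := eqVneq (rnorm x) 0.
    by rewrite (rnorm_eq0 nx) rnorm0 linear_fun0 // -rnorm_sqr rnorm0 expr0n mulr0.
  have nx0 : 0 < rnorm x ^+ 2 by rewrite exprn_gt0 // lt0r nx rnorm_ge0.
  have : m <= rinner (A ((rnorm x)^-1%:C *: x)) ((rnorm x)^-1%:C *: x).
    by apply: ge_inf; [exact: Ei.2|exists ((rnorm x)^-1%:C *: x) => //; exact: unit].
  rewrite linear_funZ // !rinnerE mulrA -invfM -expr2 mulrC ler_pdivlMr //.
split=> // e e0.
have N0 : 0 < M + `|m| by rewrite ltr_wpDr.
have [|_ [x /= x1 <-] xm] := inf_adherent (_ : 0 < e ^+ 2 / (M + `|m|)) Ei.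
  by rewrite divr_gt0 ?exprn_gt0.
exists x; rewrite x1 mulr1.
pose K := horner_op A ('X - m%:P).
have KE y : K y = A y - m%:C *: y by rewrite /K horner_op_XsubC.
have Kl : linear K by exact: horner_op_linear.
have Kr y : rinner (K y) y = rinner (A y) y - m * rnorm y ^+ 2.
  by rewrite KE !rinnerE rnorm_sqr.
have Ks : self_adjoint K by exact: horner_op_self_adjoint.
have Kx : rnorm (K x) ^+ 2 <= (M + `|m|) * rinner (K x) x.
  apply: psd_rnorm_le => // y; first by rewrite Kr subr_ge0.
  rewrite Kr mulrDl lerD //; first by apply: (le_trans (ler_norm _)).
  by rewrite -mulNr ler_wpM2r ?exprn_ge0 ?rnorm_ge0 // -normrN ler_norm.
rewrite -KE -(ltr_pXn2r (_ : 0 < 2)%N) ?nnegrE ?rnorm_ge0 ?(ltW e0) //.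
apply: (le_lt_trans Kx); rewrite mulrC -ltr_pdivlMr // Kr x1 expr1n mulr1 ltrBlDl.
exact: xm.
Qed.

End ApproximateSpectrum.

(** * Norms of polynomials of a self-adjoint operator *)

Section SpectralNormBound.
Variables (R : realType) (H : hilbertSpace R).
Implicit Types (x y : H) (a b c t e : R) (A T : H -> H) (p q : {poly R}).

Lemma approx_eigenvalue_ge A a t : (forall x, a * rnorm x ^+ 2 <= rinner (A x) x) ->
  approx_eigenvalue A t%:C -> a <= t.
Proof.
move=> Aa At; rewrite leNgt; apply/negP => ta.
have [x xt] := At (a - t) ltac:(by rewrite subr_gt0).
have x0 := rnorm_lt_gt0 xt.
have := rinner_le (A x - t%:C *: x) x; rewrite !rinnerE -rnorm_sqr => h.
have := Aa x; nra.
Qed.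

Lemma approx_eigenvalue_le A b t : (forall x, rinner (A x) x <= b * rnorm x ^+ 2) ->
  approx_eigenvalue A t%:C -> t <= b.
Proof.
move=> Ab At; rewrite leNgt; apply/negP => bt.
have [x xt] := At (t - b) ltac:(by rewrite subr_gt0).
have x0 := rnorm_lt_gt0 xt.
have := rinner_le (- (A x - t%:C *: x)) x; rewrite rnormN !rinnerE -rnorm_sqr => h.
have := Ab x; nra.
Qed.

(** If $M$ is the norm of $p(A)$ then vectors on which it is almost attained
   show that $M^2$ is an approximate eigenvalue of $p(A)^2$; hence a root of
   $p^2 - M^2$ is an approximate eigenvalue of $A$. *)
Lemma opnorm_horner_attained A p : bounded_operator A -> self_adjoint A ->
  (exists x : H, rnorm x != 0) ->
  exists2 t, approx_eigenvalue A t%:C & `|p.[t]| = opnorm (horner_op A p).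
Proof.
move=> Ab As nz; have Al := bounded_linear Ab.
set M := opnorm _; pose P := horner_op A p.
have M0 : 0 <= M := opnorm_ge0 _.
have Pb : bounded_operator P by exact: horner_op_bounded.
have Pl := bounded_linear Pb.
have Ps : self_adjoint P by exact: horner_op_self_adjoint.
pose q := p ^+ 2 - (M ^+ 2)%:P.
suff [t At qt] : exists2 t, approx_eigenvalue A t%:C & q.[t] = 0.
  exists t => //; move/eqP: qt; rewrite !hornerE subr_eq0 => /eqP pt.
  by apply/eqP; rewrite -(eqrXn2 (_ : 0 < 2)%N) // -normrX pt ger0_norm ?sqr_ge0.
(* Then [p] is constant, and any approximate eigenvalue will do. *)
have [q0|q0] := eqVneq q 0.
  have [m [Am _]] := approx_eigenvalue_min Ab As nz.
  by exists m => //; rewrite q0 horner0.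
have qE x : horner_op A q x = P (P x) - (M ^+ 2)%:C *: x.
  by rewrite horner_opB horner_opC expr2 horner_opM.
(* As $\|P^2 x - M^2 x\|^2 = \|P^2 x\|^2 - 2 M^2 \|P x\|^2 + M^4 \|x\|^2$. *)
have qx x : rnorm (horner_op A q x) ^+ 2 <=
    M ^+ 2 * (M ^+ 2 * rnorm x ^+ 2 - rnorm (P x) ^+ 2).
  have PPx : rnorm (P (P x)) ^+ 2 <= M ^+ 2 * rnorm (P x) ^+ 2.
    by rewrite -exprMn lerXn2r ?nnegrE ?mulr_ge0 ?rnorm_ge0 //; exact: opnorm_ub.
  rewrite rnorm_sqr qE !rinnerE (rinnerC x) (self_adjoint_rinner _ x Ps).
  rewrite -!rnorm_sqr; lra.
have qsmall e : 0 < e -> exists x, rnorm (ceval A (map_poly (real_complex R) q) x) < e * rnorm x.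
  move=> e0; have [M00|M00] := eqVneq M 0.
    have [x x0] := nz; exists x; rewrite -horner_opE.
    have := qx x; rewrite M00 expr0n mul0r => h.
    have -> : rnorm (horner_op A q x) = 0.
      by apply/eqP; rewrite -sqrf_eq0 eq_le h sqr_ge0.
    by rewrite mulr_gt0 // lt0r x0 rnorm_ge0.
  have Mp : 0 < M by rewrite lt0r M00.
  (* If [P x] has norm at least $(M - d)\|x\|$, then by [qx] that of [q(A) x] is
     at most $\sqrt{2 M^3 d}\,\|x\|$. *)
  pose d := Num.min M (e ^+ 2 / (4 * M ^+ 3)).
  have d0 : 0 < d by rewrite lt_min Mp divr_gt0 ?exprn_gt0 ?mulr_gt0 ?exprn_gt0.
  have dM : d <= M by rewrite ge_min lexx.
  have de : 4 * M ^+ 3 * d <= e ^+ 2.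
    by rewrite mulrC -ler_pdivlMr ?mulr_gt0 ?exprn_gt0 // ge_min lexx orbT.
  have [x xd] : exists x, (M - d) * rnorm x < rnorm (P x).
    apply: contrapT => /forallNP h; suff : M <= M - d by lra.
    apply: opnorm_le; first by rewrite subr_ge0.
    by move=> x; rewrite leNgt; apply/negP; exact: h.
  have x0 : 0 < rnorm x.
    rewrite lt0r rnorm_ge0 andbT; apply: contraTneq xd => /rnorm_eq0 ->.
    by rewrite linear_fun0 // rnorm0 mulr0 ltxx.
  exists x; rewrite -horner_opE -(ltr_pXn2r (_ : 0 < 2)%N) ?nnegrE ?rnorm_ge0 ?mulr_ge0 ?(ltW e0) ?(ltW x0) //.
  apply: (le_lt_trans (qx x)); rewrite exprMn.
  have xd2 : ((M - d) * rnorm x) ^+ 2 <= rnorm (P x) ^+ 2.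
    by rewrite lerXn2r ?nnegrE ?mulr_ge0 ?subr_ge0 ?rnorm_ge0 // ltW.
  apply: (@le_lt_trans _ _ (2 * M ^+ 3 * d * rnorm x ^+ 2)).
    rewrite (_ : 2 * M ^+ 3 * d * rnorm x ^+ 2 = M ^+ 2 * (2 * M * d * rnorm x ^+ 2)); last by ring.
    rewrite ler_wpM2l ?sqr_ge0 //; move: xd2; rewrite exprMn.
    have : 0 <= d ^+ 2 * rnorm x ^+ 2 by rewrite mulr_ge0 ?sqr_ge0.
    lra.
  rewrite ltr_pM2r ?exprn_gt0 //.
  by have : 0 < M ^+ 3 * d by [rewrite mulr_gt0 ?exprn_gt0]; lra.
have q0C : map_poly (real_complex R) q != 0 by rewrite map_poly_eq0.
have [z qz Az] := approx_eigenvalue_root Al q0C qsmall.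
have zR := approx_eigenvalue_real As Az; exists (complex.Re z); first by rewrite -zR.
by move: qz; rewrite zR fmorph_root => /rootP.
Qed.

Lemma rnorm_horner_op_le A p c : bounded_operator A -> self_adjoint A -> 0 <= c ->
  (forall t, approx_eigenvalue A t%:C -> `|p.[t]| <= c) ->
  forall x, rnorm (horner_op A p x) <= c * rnorm x.
Proof.
move=> Ab As c0 pc x; have Pb := horner_op_bounded p Ab.
have [x0|x0] := eqVneq (rnorm x) 0.
  by rewrite (rnorm_eq0 x0) (linear_fun0 (bounded_linear Pb)) rnorm0 mulr0.
have [t At pt] := opnorm_horner_attained p Ab As (ex_intro _ x x0).
by apply: (le_trans (opnorm_ub x Pb)); rewrite -pt ler_wpM2r ?rnorm_ge0 ?pc.
Qed.

(** The operator is the pointwise limit, which exists as [H] is complete; the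
   estimate of the differences passes to the limit. *)
Lemma horner_op_limit A (p : nat -> {poly R}) : bounded_operator A ->
  (forall e, 0 < e -> exists N, forall k l, (N <= k)%N -> (N <= l)%N ->
     forall x, rnorm (horner_op A (p k) x - horner_op A (p l) x) <= e * rnorm x) ->
  exists2 T, bounded_operator T & forall e, 0 < e -> exists N, forall k,
    (N <= k)%N -> forall x, rnorm (horner_op A (p k) x - T x) <= e * rnorm x.
Proof.
move=> Ab pc.
have lim x : exists l, forall e, 0 < e -> exists N, forall k, (N <= k)%N ->
    rnorm (horner_op A (p k) x - l) < e.
  apply: cauchy_seq_lim => e e0.
  have x1 : 0 < rnorm x + 1 by rewrite ltr_wpDl ?rnorm_ge0.
  have [N hN] := pc (e / (rnorm x + 1)) ltac:(by rewrite divr_gt0).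
  exists N => k l Nk Nl; apply: (le_lt_trans (hN k l Nk Nl x)).
  by rewrite mulrAC ltr_pdivrMr // ltr_pM2l // ltrDl.
have [T Tlim] := choice lim.
have TN e : 0 < e -> exists N, forall k, (N <= k)%N -> forall x,
    rnorm (horner_op A (p k) x - T x) <= e * rnorm x.
  move=> e0; have [N hN] := pc e e0; exists N => k Nk x.
  apply/ler_addgt0Pl => d d0; have [N' hN'] := Tlim x d d0.
  apply: (le_trans (rnorm_dist _ (horner_op A (p (maxn N N')) x) _)).
  rewrite addrC lerD ?hN ?leq_maxl //; apply: ltW; apply: hN'.
  by rewrite leq_maxr.
exists T => //.
have Tl : linear T.
  move=> z x y; apply/eqP; rewrite -subr_eq0; apply/eqP/rnorm_eq0/eqP.
  rewrite eq_le rnorm_ge0 andbT; apply/ler_addgt0Pl => d d0; rewrite addr0.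
  pose K := rnorm (z *: x + y) + complex.Re `|z| * rnorm x + rnorm y + 1.
  have z0 : 0 <= complex.Re `|z| by rewrite normc_def sqrtr_ge0.
  have K0 : 0 < K by rewrite ltr_wpDl ?addr_ge0 ?mulr_ge0 ?rnorm_ge0.
  have [N hN] := TN (d / K) ltac:(by rewrite divr_gt0).
  pose P := horner_op A (p N).
  have Pl : linear P by exact: horner_op_linear (bounded_linear Ab).
  have {}hN u : rnorm (P u - T u) <= d / K * rnorm u by exact: hN.
  have -> : T (z *: x + y) - (z *: T x + T y) =
      - (P (z *: x + y) - T (z *: x + y)) + (z *: (P x - T x) + (P y - T y)).
    have -> : z *: (P x - T x) + (P y - T y) = P (z *: x + y) - (z *: T x + T y).
      by rewrite (Pl z x y) scalerBr opprD addrACA.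
    by rewrite opprB addrA subrK.
  apply: (le_trans (rnormD _ _)); rewrite rnormN.
  apply: (@le_trans _ _ (d / K * rnorm (z *: x + y) + (complex.Re `|z| * (d / K * rnorm x) + d / K * rnorm y))).
    rewrite lerD //; apply: (le_trans (rnormD _ _)); rewrite lerD // rnormZ.
    by rewrite ler_wpM2l.
  have -> : d / K * rnorm (z *: x + y) + (complex.Re `|z| * (d / K * rnorm x) + d / K * rnorm y) = d / K * (K - 1) by rewrite /K; ring.
  by rewrite mulrAC ler_pdivrMr // ler_wpM2l ?(ltW d0) // gerBl.
have [N hN] := TN 1 ltr01.
have [M M0 PM] := bounded_rnorm (horner_op_bounded (p N) Ab).
apply: (@bounded_operatorP _ _ _ (1 + M) Tl) => x.
rewrite -[T x](subrK (horner_op A (p N) x)) mulrDl; apply: (le_trans (rnormD _ _)).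
by rewrite rnormB lerD ?PM // hN.
Qed.

End SpectralNormBound.

(** * Existence and norm of the functional calculus *)

Section FunctionalCalculus.
Variables (R : realType) (H : hilbertSpace R).
Implicit Types (x y : H) (a b c t e : R) (A S T : H -> H) (p q : {poly R}) (g : R -> R).

Lemma uniform_seqP (D : set R) (u : nat -> R -> R) g :
  {uniform D, u @ \oo --> g} <->
  (forall e : R, 0 < e -> exists N, forall k t, (N <= k)%N -> D t -> `|g t - u k t| < e).
Proof.
split.
  move=> h e e0.
  have := h [set v : {uniform` D -> R} | forall t, D t -> ball (g t) e (v t)].
  case.
    apply/uniform_nbhs; exists [set xy | ball xy.1 e xy.2]; split=> //.
    exact: entourage_ball (PosNum e0).
  move=> N _ hN; exists N => k t Nk Dt; have := hN k Nk t Dt.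
  by rewrite -ball_normE.
move=> h A /uniform_nbhs[E [entE EA]].
have [e e0 eE] : exists2 e : R, 0 < e & [set xy | ball xy.1 e xy.2] `<=` E.
  by move: entE; rewrite -entourage_ballE => -[e e0 eE]; exists e.
have [N hN] := h e e0; exists N => // k Nk; apply: EA => t Dt.
by apply: eE => /=; rewrite -ball_normE /=; exact: hN.
Qed.

Lemma expr_lt_eps (rho e : R) : 0 <= rho -> rho < 1 -> 0 < e ->
  exists N, forall k, (N <= k)%N -> rho ^+ k < e.
Proof.
move=> r0 r1 e0; have : rho ^+ k @[k --> \oo] --> 0 by apply: cvg_expr; rewrite ger0_norm.
move=> /cvgrPdist_lt/(_ e e0)[N _ NE]; exists N => k /NE /=.
by rewrite sub0r normrN ger0_norm ?exprn_ge0.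
Qed.

Lemma rnorm_le_eq0 (u : H) (K : R) :
  (forall e, 0 < e -> rnorm u <= e * K) -> u = 0.
Proof.
move=> uK; apply/rnorm_eq0/eqP; rewrite eq_le rnorm_ge0 andbT.
apply/ler_addgt0Pl => d d0; rewrite addr0.
have K1 : 0 < `|K| + 1 by rewrite ltr_wpDl.
apply: (le_trans (uK (d / (`|K| + 1)) ltac:(by rewrite divr_gt0))).
rewrite mulrAC ler_pdivrMr // ler_wpM2l ?(ltW d0) //.
by apply: (le_trans (ler_norm K)); rewrite lerDl.
Qed.

(** The inverse is the limit of the partial sums of the Neumann series
   $N^{-1} \sum_j (1 - P/N)^j$. *)
Lemma coercive_inverse (P : H -> H) e : bounded_operator P -> self_adjoint P ->
  0 < e -> (forall x, e * rnorm x ^+ 2 <= rinner (P x) x) ->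
  exists2 S, bounded_operator S & cancel P S /\ cancel S P.
Proof.
move=> Pb Ps e0 Pe; have Pl := bounded_linear Pb.
have [M M0 PM] := bounded_rnorm Pb; pose N := M + e.
have N0 : 0 < N by rewrite addr_gt0.
have PN x : rinner (P x) x <= N * rnorm x ^+ 2.
  apply: (le_trans (rinner_le _ _)); rewrite expr2 mulrA ler_wpM2r ?rnorm_ge0 //.
  by apply: (le_trans (PM x)); rewrite ler_wpM2r ?rnorm_ge0 // lerDl ltW.
pose r : {poly R} := 1 - N^-1 *: 'X; pose rho := 1 - e / N.
have rho0 : 0 <= rho by rewrite subr_ge0 ler_pdivrMr // mul1r lerDr ltW.
have rho1 : rho < 1 by rewrite gtrBl divr_gt0.
pose p k : {poly R} := N^-1 *: \sum_(j < k) r ^+ j.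
have pX k : p k * 'X = 1 - r ^+ k.
  rewrite -opprB subrX1 -mulNr opprB /r opprB addrC subrK /p.
  by rewrite -!scalerAl mulrC.
have rt k t : approx_eigenvalue P t%:C -> `|(r ^+ k).[t]| <= rho ^+ k.
  move=> Pt; have te := approx_eigenvalue_ge Pe Pt.
  have tN := approx_eigenvalue_le PN Pt.
  rewrite horner_exp normrX lerXn2r ?nnegrE //; rewrite /r !hornerE mulrC.
  rewrite ger0_norm ?subr_ge0 ?ler_pdivrMr ?mul1r // lerD2l lerN2.
  by rewrite ler_wpM2r ?invr_ge0 ?(ltW N0).
have rP k x : rnorm (horner_op P (r ^+ k) x) <= rho ^+ k * rnorm x.
  by apply: rnorm_horner_op_le => //; [exact: exprn_ge0|exact: rt].
have [|S Sb Slim] := @horner_op_limit _ _ P p Pb.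
  move=> d d0; have [n hn] := @expr_lt_eps rho (e * d / 2) rho0 rho1 ltac:(by rewrite divr_gt0 ?mulr_gt0).
  exists n => k l nk nl x; rewrite -horner_opB.
  apply: rnorm_horner_op_le => // [|t Pt]; first exact: ltW.
  have te := approx_eigenvalue_ge Pe Pt.
  have t0 : 0 < t by exact: lt_le_trans te.
  rewrite -(ler_pM2l t0) -{1}(gtr0_norm t0) -normrM.
  have -> : t * (p k - p l).[t] = (r ^+ l).[t] - (r ^+ k).[t].
    have pkt m : t * (p m).[t] = 1 - (r ^+ m).[t].
      rewrite mulrC -hornerMX pX hornerD hornerN.
      by rewrite -polyC1 hornerC.
    by rewrite hornerD hornerN mulrBr !pkt; ring.
  apply: (le_trans (ler_normB _ _)).
  apply: (@le_trans _ _ (e * d)); last by rewrite ler_wpM2r ?(ltW d0).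
  have := rt k t Pt; have := rt l t Pt; have := hn k nk; have := hn l nl; lra.
have key d : 0 < d -> exists k, (forall x, rnorm (horner_op P (p k) x - S x) <= d * rnorm x) /\
    forall x, rnorm (horner_op P (p k * 'X) x - x) <= d * rnorm x.
  move=> d0; have [n hn] := Slim d d0; have [m hm] := expr_lt_eps rho0 rho1 d0.
  exists (maxn n m); split=> x; first by apply: hn; rewrite leq_maxl.
  rewrite pX horner_opB -polyC1 horner_opC scale1r rnormB opprB addrC subrK.
  apply: (le_trans (rP _ x)); rewrite ler_wpM2r ?rnorm_ge0 // ltW // hm //.
  exact: leq_maxr.
exists S => //; split=> x; apply/eqP; rewrite -subr_eq0; apply/eqP.
  apply: (@rnorm_le_eq0 _ (rnorm (P x) + rnorm x)) => d d0.
  have [k [kS kX]] := key d d0.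
  apply: (le_trans (rnorm_dist _ (horner_op P (p k) (P x)) _)).
  rewrite mulrDr lerD //; first by rewrite rnormB.
  by have := kX x; rewrite horner_opM // horner_opX.
apply: (@rnorm_le_eq0 _ (M * rnorm x + rnorm x)) => d d0.
have [k [kS kX]] := key d d0.
apply: (le_trans (rnorm_dist _ (P (horner_op P (p k) x)) _)).
rewrite mulrDr lerD //; last first.
  by have := kX x; rewrite mulrC horner_opM // horner_opX.
rewrite -(linear_funB _ _ Pl); apply: (le_trans (PM _)).
by rewrite mulrCA ler_wpM2l ?(ltW M0) // rnormB.
Qed.

Lemma spectrum_ge A a t : bounded_operator A -> self_adjoint A ->
  (forall x, a * rnorm x ^+ 2 <= rinner (A x) x) -> spectrum A t%:C -> a <= t.
Proof.
move=> Ab As Aa At; rewrite leNgt; apply/negP => ta; apply: At.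
have Al := bounded_linear Ab.
have [||||S Sb [PS SP]] := @coercive_inverse (horner_op A ('X - t%:P)) (a - t).
- exact: horner_op_bounded.
- exact: horner_op_self_adjoint.
- by rewrite subr_gt0.
- move=> x; rewrite horner_op_XsubC // !rinnerE -rnorm_sqr.
  by rewrite mulrBl lerD2r.
exists S => //; split=> x /=; first by rewrite -[RHS]PS horner_op_XsubC.
by rewrite -[RHS]SP horner_op_XsubC.
Qed.

Lemma spectrum_le A b t : bounded_operator A -> self_adjoint A ->
  (forall x, rinner (A x) x <= b * rnorm x ^+ 2) -> spectrum A t%:C -> t <= b.
Proof.
move=> Ab As Aa At; rewrite leNgt; apply/negP => tb; apply: At.
have Al := bounded_linear Ab.
have PE x : horner_op A (t%:P - 'X) x = - (A x - t%:C *: x).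
  by rewrite horner_opB horner_opX // horner_opC opprB.
have [||||S Sb [PS SP]] := @coercive_inverse (horner_op A (t%:P - 'X)) (t - b).
- exact: horner_op_bounded.
- exact: horner_op_self_adjoint.
- by rewrite subr_gt0.
- move=> x; rewrite PE !rinnerE -rnorm_sqr.
  by rewrite mulrBl opprB lerD2l lerN2.
have Sl := bounded_linear Sb; have [K K0 SK] := bounded_rnorm Sb.
exists (fun x => - S x).
  apply: (@bounded_operatorP _ _ _ K) => [z x y|x]; last by rewrite rnormN.
  by rewrite (Sl z x y) opprD scalerN.
split=> x /=; first by rewrite -[RHS]PS PE (linear_funN _ Sl).
rewrite -[RHS]SP PE; transitivity (A (- S x) - t%:C *: (- S x)) => //.
by rewrite (linear_funN _ Al) scalerN -opprD.
Qed.

(** The polynomials approximating [g] on an interval containing the numerical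
   range serve on the spectrum. *)
Lemma is_cfc_exists A g a b (p : nat -> {poly R}) :
  bounded_operator A -> self_adjoint A ->
  (forall x, a * rnorm x ^+ 2 <= rinner (A x) x) ->
  (forall x, rinner (A x) x <= b * rnorm x ^+ 2) ->
  (forall e, 0 < e -> exists N, forall k t, (N <= k)%N -> a <= t -> t <= b ->
     `|g t - (p k).[t]| < e) ->
  exists T, is_cfc A g T.
Proof.
move=> Ab As Aa Ale pg.
have [|T Tb Tlim] := @horner_op_limit _ _ A p Ab.
  move=> d d0; have [n hn] := pg (d / 2) ltac:(by rewrite divr_gt0).
  exists n => k l nk nl x; rewrite -horner_opB.
  apply: rnorm_horner_op_le => // [|t At]; first exact: ltW.
  have ta := approx_eigenvalue_ge Aa At; have tb := approx_eigenvalue_le Ale At.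
  have := hn k t nk ta tb; have := hn l t nl ta tb; rewrite hornerD hornerN.
  by rewrite !ltr_norml ler_norml => /andP[? ?] /andP[? ?]; apply/andP; split; lra.
exists T; split=> //; exists p; split.
  apply/uniform_seqP => e e0; have [n hn] := pg e e0; exists n => k t nk At.
  by apply: hn => //; [exact: spectrum_ge Aa At|exact: spectrum_le Ale At].
apply/cvgrPdist_lt => e e0; have [n hn] := Tlim (e / 2) ltac:(by rewrite divr_gt0).
exists n => // k nk; rewrite /= sub0r normrN ger0_norm ?opnorm_ge0 //.
apply: (@le_lt_trans _ _ (e / 2)); last by rewrite ltr_pdivrMr //; lra.
by apply: opnorm_le => [|x]; [rewrite divr_ge0 // ltW|exact: hn].
Qed.

Lemma is_cfc_approx A g T e : bounded_operator A -> is_cfc A g T -> 0 < e ->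
  exists2 p : {poly R}, (forall t, spectrum A t%:C -> `|g t - p.[t]| < e) &
    forall x, rnorm (horner_op A p x - T x) <= e * rnorm x.
Proof.
move=> Ab [Tb [p [pg /cvgrPdist_lt pT]]] e0.
have [n hn] := (uniform_seqP _ _ _).1 pg e e0; have [m _ hm] := pT e e0.
exists (p (maxn n m)) => [t At|x]; first by apply: hn => //; exact: leq_maxl.
have := hm (maxn n m) (leq_maxr _ _); rewrite /= sub0r normrN ger0_norm ?opnorm_ge0 // => h.
have Db : bounded_operator (horner_op A (p (maxn n m)) - T).
  have Pb := horner_op_bounded (p (maxn n m)) Ab.
  have [K K0 PK] := bounded_rnorm Pb; have [K' K'0 TK] := bounded_rnorm Tb.
  apply: (@bounded_operatorP _ _ _ (K + K')) => [z x' y|x'].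
    transitivity (horner_op A (p (maxn n m)) (z *: x' + y) - T (z *: x' + y)) => //.
    rewrite (bounded_linear Pb z x' y) (bounded_linear Tb z x' y) opprD addrACA.
    by rewrite -scalerBr.
  by rewrite mulrDl; apply: (le_trans (rnormD _ _)); rewrite rnormN lerD // PK.
by apply: (le_trans (opnorm_ub x Db)); rewrite ler_wpM2r ?rnorm_ge0 // ltW.
Qed.

(** As $p - p(t)$ is divisible by $X - t$. *)
Lemma approx_eigenvalue_horner A p t e : bounded_operator A ->
  approx_eigenvalue A t%:C -> 0 < e ->
  exists x, rnorm (horner_op A p x - p.[t]%:C *: x) < e * rnorm x.
Proof.
move=> Ab At e0; have Al := bounded_linear Ab.
have /factor_theorem[q qE] : root (p - p.[t]%:P) t by rewrite rootE !hornerE subrr.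
have [K K0 qK] := bounded_rnorm (horner_op_bounded q Ab).
have [x xe] := At (e / K) ltac:(by rewrite divr_gt0); exists x.
have -> : horner_op A p x - p.[t]%:C *: x = horner_op A (p - p.[t]%:P) x.
  by rewrite horner_opB horner_opC.
rewrite qE horner_opM // horner_op_XsubC //.
apply: (le_lt_trans (qK _)); rewrite mulrC -ltr_pdivlMr //.
by rewrite mulrAC.
Qed.

Lemma is_cfc_opnorm_ge A g T t : bounded_operator A -> is_cfc A g T ->
  approx_eigenvalue A t%:C -> `|g t| <= opnorm T.
Proof.
move=> Ab Tg At; have Al := bounded_linear Ab; have Tb := Tg.1.
apply/ler_addgt0Pl => d d0.
have d3 : 0 < d / 3 by rewrite divr_gt0.
have [p pg pT] := is_cfc_approx Ab Tg d3.
have [x xp] := approx_eigenvalue_horner p Ab At d3.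
have x0 := rnorm_lt_gt0 xp.
have gp := pg t (approx_eigenvalue_spectrum At).
have h : `|p.[t]| * rnorm x <= rnorm (T x) + d / 3 * rnorm x + d / 3 * rnorm x.
  rewrite -rnormZr -[_ *: x](subrK (horner_op A p x)).
  apply: (le_trans (rnormD _ _)); rewrite addrC lerD //; last by rewrite rnormB ltW.
  rewrite -[horner_op A p x](subrK (T x)) addrC.
  by apply: (le_trans (rnormD _ _)); rewrite lerD2l.
have h2 : `|g t| <= d / 3 + `|p.[t]|.
  rewrite -[g t](subrK p.[t]); apply: (le_trans (ler_normD _ _)).
  by rewrite lerD2r ltW.
have h3 := opnorm_ub x Tb.
rewrite -(ler_pM2r x0); nra.
Qed.

Lemma is_cfc_opnorm_le A g T c : bounded_operator A -> self_adjoint A ->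
  is_cfc A g T -> 0 <= c ->
  (forall t, approx_eigenvalue A t%:C -> `|g t| <= c) -> opnorm T <= c.
Proof.
move=> Ab As Tg c0 gc; apply: opnorm_le => // x.
apply/ler_addgt0Pl => d d0; set e := d / (2 * (rnorm x + 1)).
have x1 : 0 < rnorm x + 1 by rewrite ltr_wpDl ?rnorm_ge0.
have e0 : 0 < e by rewrite divr_gt0 ?mulr_gt0.
have [p pg pT] := is_cfc_approx Ab Tg e0.
rewrite -[T x](subrK (horner_op A p x)); apply: (le_trans (rnormD _ _)).
have px : rnorm (horner_op A p x) <= (c + e) * rnorm x.
  apply: rnorm_horner_op_le => // [|t At]; first by rewrite addr_ge0 // ltW.
  have := pg t (approx_eigenvalue_spectrum At); have := gc t At.
  by rewrite ltr_norml !ler_norml => /andP[? ?] /andP[? ?]; apply/andP; split; lra.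
have ex : 2 * (e * rnorm x) <= d.
  rewrite /e mulrAC mulrA ler_pdivrMr ?mulr_gt0 //.
  by have := rnorm_ge0 x; nra.
have := pT x; rewrite rnormB; lra.
Qed.

End FunctionalCalculus.

(** * Euclidean spaces *)

Section EuclideanSpace.
Variables (R : realType) (n : nat).
Local Notation C := R[i].

(** A fresh name: the row vectors themselves carry the sup norm. *)
Definition euclid : Type := 'rV[C]_n.

HB.instance Definition _ := GRing.Lmodule.copy euclid 'rV[C]_n.

Definition euclid_norm (u : euclid) : C := sqrtC (dotmx u u).

Lemma euclid_normD (u v : euclid) : euclid_norm (u + v) <= euclid_norm u + euclid_norm v.
Proof. exact: (triangle_lerif (@dotmx C n) u v).1. Qed.

Lemma euclid_normZ (z : C) (u : euclid) : euclid_norm (z *: u) = `|z| * euclid_norm u.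
Proof.
rewrite /euclid_norm (dnormZ (@dotmx C n)) rootCMl ?exprn_ge0 // sqrCK //.
Qed.

Lemma euclid_norm_eq0 (u : euclid) : euclid_norm u = 0 -> u = 0.
Proof. by move/eqP; rewrite (sqrt_dnorm_eq0 (@dotmx C n)) => /eqP. Qed.

HB.instance Definition _ := Lmodule_isNormed.Build C euclid
  euclid_normD euclid_normZ euclid_norm_eq0.

Lemma euclid_normE (u : euclid) : `|u| = sqrtC (dotmx u u).
Proof. by []. Qed.

Lemma dotmx_sum (u v : 'rV[C]_n) : dotmx u v = \sum_i u 0 i * Num.conj (v 0 i).
Proof. by rewrite dotmxE mxE; apply: eq_bigr => i _; rewrite !mxE. Qed.

Lemma euclid_coord_le (u : euclid) i : `|u 0 i| <= `|u|.
Proof.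
rewrite -(ler_pXn2r (_ : 0 < 2)%N) ?nnegrE // euclid_normE sqrtCK dotmx_sum normCK.
by rewrite (bigD1 i) //= lerDl sumr_ge0 // => j _; exact: mul_conjC_ge0.
Qed.

Lemma euclid_le_sum (u : euclid) : `|u| <= \sum_i `|u 0 i|.
Proof.
rewrite [X in `|X|](_ : u = \sum_i (u 0 i *: (delta_mx 0 i : euclid)) :> euclid); last first.
  exact: row_sum_delta.
apply: (le_trans (ler_norm_sum _ _ _)); apply: ler_sum => i _.
rewrite normrZ ler_piMr // -(ler_pXn2r (_ : 0 < 2)%N) ?nnegrE //.
rewrite euclid_normE sqrtCK dotmx_sum (bigD1 i) //= big1 => [|j ji].
  by rewrite !mxE !eqxx addr0 conjC1 mulr1 expr1n.
by rewrite !mxE (negbTE ji) mul0r.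
Qed.

Lemma Re_lip (z w : C) : `|complex.Re z - complex.Re w|%:C <= `|z - w|.
Proof. by apply: le_trans (normc_ge_Re (z - w)); case: z w => ? ? []. Qed.

Lemma Im_lip (z w : C) : `|complex.Im z - complex.Im w|%:C <= `|z - w|.
Proof.
have -> : complex.Im z - complex.Im w = complex.Im (z - w) by case: z w => ? ? [].
rewrite normc_def lecR -sqrtr_sqr ler_sqrt ?addr_ge0 ?sqr_ge0 //.
by rewrite lerDr sqr_ge0.
Qed.

Lemma norm_le_ReIm (z : C) : `|z| <= (`|complex.Re z| + `|complex.Im z|)%:C.
Proof.
rewrite normc_def lecR -[leRHS]ger0_norm ?addr_ge0 // -sqrtr_sqr ler_sqrt ?sqr_ge0 //.
by rewrite sqrrD !real_normK ?num_real // addrAC lerDl mulrn_wge0 // mulr_ge0.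
Qed.

(** The real and imaginary parts of the coordinates converge. *)
Lemma euclid_complete (F : set_system euclid) : ProperFilter F -> cauchy F -> cvg F.
Proof.
move=> FF Fc.
have coord (f : C -> R) i : (forall z w, `|f z - f w|%:C <= `|z - w|) ->
    exists l : R, (fun u : euclid => f (u 0 i)) @ F --> l.
  move=> flip; suff : cvg ((fun u : euclid => f (u 0 i)) @ F) by case/cvg_ex => l; exists l.
  apply/cauchy_cvgP/cauchy_exP => e e0.
  have eC : 0 < e%:C :> C by rewrite (ltcR 0).
  have [u Fu] := (cauchyP F).1 Fc _ eC; exists (f (u 0 i)).
  suff : F [set v : euclid | ball (f (u 0 i)) e (f (v 0 i))] by [].
  apply: filterS Fu => v; rewrite -ball_normE /= => uv.
  rewrite -ball_normE /= -ltcR; apply: (le_lt_trans (flip _ _)).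
  apply: le_lt_trans uv; have := euclid_coord_le (u - v) i.
  by rewrite !mxE.
have [a Fa] := choice (fun i => coord (@complex.Re R) i (fun z w => Re_lip z w)).
have [b Fb] := choice (fun i => coord (@complex.Im R) i (fun z w => Im_lip z w)).
apply/cvg_ex; exists (\row_i (a i +i* b i)).
apply/cvgrPdist_lt => e e0.
have eR : e = (complex.Re e)%:C by rewrite RRe_real // gtr0_real.
have r0 : 0 < complex.Re e by rewrite -ltcR -eR.
pose d := complex.Re e / (2 * n.+1%:R).
have d0 : 0 < d by rewrite divr_gt0 ?mulr_gt0.
have Fall : F [set u : euclid | forall i, `|a i - complex.Re (u 0 i)| < d /\ `|b i - complex.Im (u 0 i)| < d].
  apply: filter_forall => i; apply: filterI.
    by move/cvgrPdist_lt : (Fa i) => /(_ d d0).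
  by move/cvgrPdist_lt : (Fb i) => /(_ d d0).
apply: filterS Fall => u hu; apply: (le_lt_trans (euclid_le_sum _)).
apply: (@le_lt_trans _ _ (\sum_(i < n) (2 * d)%:C)).
  apply: ler_sum => i _; rewrite !mxE.
  apply: (le_trans (norm_le_ReIm _)); rewrite lecR.
  have [h1 h2] := hu i; move: (u 0 i) h1 h2 => [x y] /= h1 h2.
  by rewrite mulr_natl mulr2n; apply: lerD; exact: ltW.
rewrite -raddf_sum /= sumr_const card_ord eR ltcR /d.
have n0 : 0 < n.+1%:R :> R by rewrite ltr0n.
have -> : 2 * (complex.Re e / (2 * n.+1%:R)) *+ n = complex.Re e * (n%:R / n.+1%:R).
  by rewrite -[LHS]mulr_natr; field; rewrite nat1r gt_eqF.
by rewrite gtr_pMr // ltr_pdivrMr // mul1r ltr_nat.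
Qed.

HB.instance Definition _ := Uniform_isComplete.Build euclid euclid_complete.

Definition euclid_inner (u v : euclid) : C := dotmx u v.

HB.instance Definition _ := Bilinear.copy euclid_inner (@dotmx C n).
HB.instance Definition _ := Hermitian.copy euclid_inner (@dotmx C n).
HB.instance Definition _ := Dot.copy euclid_inner (@dotmx C n).

End EuclideanSpace.

(** * Operators with an orthonormal basis of real eigenvectors *)

Section OrthogonalDiagonalization.
Variables (R : realType) (n : nat).
Local Notation C := R[i].
Local Notation E := (euclid R n).

Lemma euclid_innerE (u : E) : `|u| ^+ 2 = euclid_inner u u.
Proof. by rewrite euclid_normE sqrtCK. Qed.

Definition euclid_hilbert : hilbertSpace R := HilbertSpace euclid_innerE.

Definition cmx (V : 'M[R]_n) : 'M[C]_n := map_mx (real_complex R) V.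

(** For an orthogonal [V], whose columns are then the eigenvectors. The eigenvalues
   may be complex, so that the resolvents have the same form. *)
Definition diag_op (V : 'M[R]_n) (d : 'I_n -> C) (u : euclid_hilbert) : euclid_hilbert :=
  \row_j (d j * (u *m cmx V : 'rV_n) 0 j) *m (cmx V)^T.

Variable V : 'M[R]_n.
Hypothesis VVT : V *m V^T = 1%:M.

Let cVTV : (cmx V)^T *m cmx V = 1%:M.
Proof. by rewrite /cmx map_trmx -map_mxM (mulmx1C VVT) map_mx1. Qed.

Let cVVT : cmx V *m (cmx V)^T = 1%:M.
Proof. by rewrite /cmx map_trmx -map_mxM VVT map_mx1. Qed.

Lemma diag_op_coord d u j : (diag_op V d u *m cmx V : 'rV_n) 0 j = d j * (u *m cmx V : 'rV_n) 0 j.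
Proof. by rewrite /diag_op -mulmxA cVTV mulmx1 mxE. Qed.

Let coordD (u v : 'rV[C]_n) j : ((u + v) *m cmx V) 0 j = (u *m cmx V) 0 j + (v *m cmx V) 0 j.
Proof. by rewrite mulmxDl [LHS]mxE. Qed.

Let coordZ z (u : 'rV[C]_n) j : ((z *: u) *m cmx V) 0 j = z * (u *m cmx V) 0 j.
Proof. by rewrite -scalemxAl [LHS]mxE. Qed.

Let coord0 j : ((0 : 'rV[C]_n) *m cmx V) 0 j = 0.
Proof. by rewrite mul0mx mxE. Qed.

Lemma eigen_coord_inj (u v : 'rV[C]_n) :
  (forall j, (u *m cmx V) 0 j = (v *m cmx V) 0 j) -> u = v.
Proof.
by move=> uv; rewrite -[u]mulmx1 -[v]mulmx1 -cVVT !mulmxA; congr (_ *m _); apply/rowP.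
Qed.

Lemma euclid_inner_coord (u v : euclid_hilbert) : inner euclid_hilbert u v =
  \sum_j (u *m cmx V : 'rV_n) 0 j * Num.conj ((v *m cmx V : 'rV_n) 0 j).
Proof.
rewrite /= /euclid_inner -[LHS]/(dotmx _ _) -dotmx_sum !dotmxE trmx_mul map_mxM.
have -> : map_mx Num.conj (cmx V)^T = (cmx V)^T.
  by apply/matrixP => i j; rewrite !mxE conj_real.
by rewrite mulmxA -[u *m _ *m _]mulmxA cVVT mulmx1.
Qed.

Lemma diag_op_comp d d' u : diag_op V d (diag_op V d' u) = diag_op V (fun j => d j * d' j) u.
Proof. by apply: eigen_coord_inj => j; rewrite !diag_op_coord mulrA. Qed.

Lemma diag_op1 (d : 'I_n -> C) u : (forall j, d j = 1) -> diag_op V d u = u.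
Proof. by move=> d1; apply: eigen_coord_inj => j; rewrite diag_op_coord d1 mul1r. Qed.

Lemma diag_op_subZ d z u : diag_op V d u - z *: u = diag_op V (fun j => d j - z) u.
Proof.
apply: eigen_coord_inj => j.
by rewrite -scaleNr coordD coordZ !diag_op_coord mulNr -mulrBl.
Qed.

Lemma diag_op_linear d : linear (diag_op V d).
Proof.
move=> z u v; apply: eigen_coord_inj => j.
by rewrite diag_op_coord !coordD !coordZ !diag_op_coord mulrDr mulrCA.
Qed.

Lemma Re_mul_conj (z : C) : complex.Re (z * Num.conj z) = complex.Re `|z| ^+ 2.
Proof. by rewrite -normCK normc_def !expr2 /= mulr0 subr0. Qed.

Lemma rnorm_sqr_coord (u : euclid_hilbert) :
  rnorm u ^+ 2 = \sum_j complex.Re `|(u *m cmx V : 'rV_n) 0 j| ^+ 2.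
Proof.
rewrite rnorm_sqr /rinner euclid_inner_coord.
rewrite (raddf_sum (@complex.Re R : Rcomplex R -> R)); apply: eq_bigr => j _.
exact: Re_mul_conj.
Qed.

Lemma diag_op_bounded d : bounded_operator (diag_op V d).
Proof.
pose K := \sum_j complex.Re `|d j|.
have d0 j : 0 <= complex.Re `|d j| by rewrite normc_def sqrtr_ge0.
have K0 : 0 <= K by rewrite sumr_ge0.
apply: (@bounded_operatorP _ _ _ K (@diag_op_linear d)) => u.
rewrite -(ler_pXn2r (_ : 0 < 2)%N) ?nnegrE ?mulr_ge0 ?rnorm_ge0 //.
rewrite exprMn !rnorm_sqr_coord mulr_sumr; apply: ler_sum => j _.
rewrite diag_op_coord normrM.
have ReM (z w : C) : complex.Re (`|z| * `|w|) = complex.Re `|z| * complex.Re `|w|.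
  by rewrite !normc_def /= mulr0 subr0.
rewrite ReM exprMn ler_wpM2r ?sqr_ge0 // lerXn2r ?nnegrE //.
by rewrite /K (bigD1 j) //= lerDl sumr_ge0 // => i _; exact: d0.
Qed.

Lemma diag_op_self_adjoint (d : 'I_n -> R) : self_adjoint (diag_op V (fun j => (d j)%:C)).
Proof.
move=> u v; rewrite !euclid_inner_coord; apply: eq_bigr => j _.
rewrite !diag_op_coord rmorphM mulrCA mulrA; congr (_ * _ * _).
exact/esym/conj_real.
Qed.

Lemma rinner_diag_op (d : 'I_n -> R) u : rinner (diag_op V (fun j => (d j)%:C) u) u =
  \sum_j d j * complex.Re `|(u *m cmx V : 'rV_n) 0 j| ^+ 2.
Proof.
rewrite /rinner euclid_inner_coord.
rewrite (raddf_sum (@complex.Re R : Rcomplex R -> R)); apply: eq_bigr => j _.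
by rewrite diag_op_coord -mulrA -Re_mul_conj; exact: Re_realM.
Qed.

Lemma spectrum_diag_op d z : spectrum (diag_op V d) z <-> exists j, z = d j.
Proof.
split=> [dz|[j ->] [S Sb [SK KS]]].
  apply: contrapT => /forallNP nz; apply: dz.
  have nz0 j : d j - z != 0 by rewrite subr_eq0; apply/eqP => dj; exact: (nz j).
  exists (diag_op V (fun j => (d j - z)^-1)); first exact: diag_op_bounded.
  split=> u; first rewrite -[X in diag_op _ _ X]/(diag_op V d u - z *: u) diag_op_subZ diag_op_comp.
    by apply: diag_op1 => j; rewrite mulVf.
  rewrite -[LHS]/(diag_op V d _ - z *: _) diag_op_subZ diag_op_comp.
  by apply: diag_op1 => j; rewrite mulfV.
pose u : euclid_hilbert := (delta_mx 0 j *m (cmx V)^T : 'rV[C]_n).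
have uc k : (u *m cmx V : 'rV_n) 0 k = (k == j)%:R.
  by rewrite /u -mulmxA cVTV mulmx1 mxE eqxx.
have : u = 0.
  rewrite -[u]SK -[X in S X]/(diag_op V d u - d j *: u) diag_op_subZ.
  rewrite (_ : diag_op _ _ u = 0) ?(linear_fun0 (bounded_linear Sb)) //.
  apply: eigen_coord_inj => k; rewrite diag_op_coord uc coord0.
  by case: eqP => [->|_]; rewrite ?subrr ?mul0r ?mulr0.
move=> u0; have := uc j; rewrite u0 coord0 eqxx => /esym/eqP.
by rewrite oner_eq0.
Qed.

Lemma horner_op_diag_op (d : 'I_n -> R) p u :
  horner_op (diag_op V (fun j => (d j)%:C)) p u = diag_op V (fun j => p.[d j]%:C) u.
Proof.
set A := diag_op V _; have Al : linear A by exact: diag_op_linear.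
elim/poly_ind: p u => [|p a IH] u.
  rewrite -[0]/(0%:P) horner_opC scale0r; apply: eigen_coord_inj => j.
  by rewrite diag_op_coord hornerC mul0r coord0.
have -> : horner_op A (p * 'X + a%:P) u = A (horner_op A p u) + a%:C *: u.
  by rewrite !horner_opE rmorphD rmorphM /= map_polyX map_polyC cevalD cevalMX // cevalC.
rewrite IH /A diag_op_comp; apply: eigen_coord_inj => j.
rewrite coordD coordZ !diag_op_coord !hornerE.
by rewrite -mulrDl rmorphD rmorphM /= [(d j)%:C * _]mulrC.
Qed.

Lemma cfc_diag_op (f : R -> R) (d : 'I_n -> R) u :
  cfc f (diag_op V (fun j => (d j)%:C)) u = diag_op V (fun j => (f (d j))%:C) u.
Proof.
set A := diag_op V _.
have Ab : bounded_operator A by exact: diag_op_bounded.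
have [T Tf] : exists T, is_cfc A f T.
  (* On a finite spectrum [f] agrees with an interpolation polynomial. *)
  exists (diag_op V (fun j => (f (d j))%:C)); split; first exact: diag_op_bounded.
  pose p := newton_interp f (undup [seq d j | j <- enum 'I_n]).
  have pd j : p.[d j] = f (d j).
    rewrite newton_interpE ?undup_uniq // mem_undup.
    by apply/mapP; exists j => //; rewrite mem_enum.
  exists (fun=> p); split.
    apply/(uniform_seqP _ _ _) => e e0; exists 0 => _ t _ /spectrum_diag_op[j [->]].
    by rewrite pd subrr normr0.
  have -> : horner_op A p - diag_op V (fun j => (f (d j))%:C) = 0.
    apply/funext => v; rewrite -[LHS]/(horner_op A p v - _) horner_op_diag_op.
    by under eq_fun do rewrite pd; rewrite subrr.
  apply/cvgrPdist_lt => e e0; exists 0 => // _ _ /=.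
  rewrite (_ : opnorm 0 = 0) ?subrr ?normr0 //; apply/eqP.
  rewrite eq_le opnorm_ge0 andbT opnorm_le // => x.
  by rewrite rnorm0 mul0r.
have Tg : is_cfc A f (cfc f A) by rewrite /cfc; case: xgetP => [_ -> //|/(_ T)].
apply/eqP; rewrite -subr_eq0; apply/eqP.
apply: (@rnorm_le_eq0 _ _ _ (rnorm u + rnorm u)) => e e0.
have [p pf pT] := is_cfc_approx Ab Tg e0.
apply: (le_trans (rnorm_dist _ (horner_op A p u) _)).
rewrite mulrDr lerD //; first by rewrite rnormB.
rewrite horner_op_diag_op -(ler_pXn2r (_ : 0 < 2)%N) ?nnegrE ?mulr_ge0 ?rnorm_ge0 ?(ltW e0) //.
rewrite exprMn !rnorm_sqr_coord mulr_sumr; apply: ler_sum => j _.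
have -> : ((diag_op V (fun j => p.[d j]%:C) u - diag_op V (fun j => (f (d j))%:C) u) *m cmx V : 'rV_n) 0 j =
    (p.[d j] - f (d j))%:C * (u *m cmx V : 'rV_n) 0 j.
  by rewrite -scaleN1r coordD coordZ !diag_op_coord mulN1r -mulrBl -rmorphB.
rewrite normrM [X in X ^+ 2](_ : _ = `|p.[d j] - f (d j)| * complex.Re `|(u *m cmx V : 'rV_n) 0 j|).
  rewrite exprMn ler_wpM2r ?sqr_ge0 // lerXn2r ?nnegrE ?(ltW e0) //.
  by rewrite distrC ltW //; apply: pf; apply/spectrum_diag_op; exists j.
by rewrite [`|_%:C|]normc_def /= expr0n addr0 sqrtr_sqr mul0r subr0.
Qed.

End OrthogonalDiagonalization.

(** * Operator monotonicity on Euclidean spaces *)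

Section QuadraticFormComparison.
Variables (R : realType) (n : nat).
Implicit Types (x y : 'I_n -> R) (V : 'M[R]_n) (f : R -> R).

Lemma Re_coord V (u : 'rV[R[i]]_n) j :
  complex.Re ((u *m cmx V) 0 j) = (map_mx (@complex.Re R) u *m V) 0 j.
Proof.
rewrite !mxE (raddf_sum (@complex.Re R : Rcomplex R -> R)); apply: eq_bigr => i _.
by rewrite !mxE; case: (u 0 i) => a b /=; rewrite mulr0 subr0.
Qed.

Lemma Im_coord V (u : 'rV[R[i]]_n) j :
  complex.Im ((u *m cmx V) 0 j) = (map_mx (@complex.Im R) u *m V) 0 j.
Proof.
rewrite !mxE (raddf_sum (@complex.Im R : Rcomplex R -> R)); apply: eq_bigr => i _.
by rewrite !mxE; case: (u 0 i) => a b /=; rewrite mulr0 add0r.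
Qed.

Lemma rinner_diag_op_real V (d : 'I_n -> R) (u : 'rV[R[i]]_n) : V *m V^T = 1%:M ->
  rinner (diag_op V (fun j => (d j)%:C) (u : euclid_hilbert R n)) (u : euclid_hilbert R n) =
  \sum_j d j * (map_mx (@complex.Re R) u *m V) 0 j ^+ 2 +
  \sum_j d j * (map_mx (@complex.Im R) u *m V) 0 j ^+ 2.
Proof.
move=> VV; rewrite rinner_diag_op // -big_split; apply: eq_bigr => j _ /=.
have sqrE (z : R[i]) : complex.Re `|z| ^+ 2 = complex.Re z ^+ 2 + complex.Im z ^+ 2.
  by rewrite normc_def /= sqr_sqrtr // addr_ge0 ?sqr_ge0.
by rewrite -mulrDr -Re_coord -Im_coord; congr (_ * _); exact: sqrE.
Qed.

Lemma operator_monotone_quadratic f V x y (w : 'rV[R]_n) :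
  operator_monotone `]0, +oo[ f -> V *m V^T = 1%:M ->
  (forall i, 0 < x i) -> (forall j, 0 < y j) ->
  (forall u : 'rV[R]_n, \sum_i x i * u 0 i ^+ 2 <= \sum_j y j * (u *m V) 0 j ^+ 2) ->
  \sum_i f (x i) * w 0 i ^+ 2 <= \sum_j f (y j) * (w *m V) 0 j ^+ 2.
Proof.
move=> [_ fmono] VV x0 y0 xy.
have II : 1%:M *m 1%:M^T = 1%:M :> 'M[R]_n by rewrite trmx1 mulmx1.
pose A := diag_op 1%:M (fun i => (x i)%:C); pose B := diag_op V (fun j => (y j)%:C).
have AB : loewner_le A B.
  move=> u; have uAB : rinner (A u) u <= rinner (B u) u.
    by rewrite /A /B !rinner_diag_op_real // !mulmx1 lerD.
  rewrite lecE; apply/andP; split; last exact: uAB.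
  apply/eqP; transitivity (0 : R); first exact: self_adjoint_Im (diag_op_self_adjoint VV y).
  by apply/esym; exact: self_adjoint_Im (diag_op_self_adjoint II x).
have specin W (d : 'I_n -> R) : W *m W^T = 1%:M -> (forall i, 0 < d i) ->
    spectrum_in (diag_op W (fun i => (d i)%:C)) [set` `]0, +oo[].
  move=> WW d0 z /spectrum_diag_op[//|j ->]; exists (d j) => //=.
  by rewrite in_itv /= d0.
have := fmono (euclid_hilbert R n) A B.
move=> /(_ (diag_op_bounded II _) (diag_op_self_adjoint II _) (specin _ _ II x0)).
move=> /(_ (diag_op_bounded VV _) (diag_op_self_adjoint VV _) (specin _ _ VV y0) AB).
pose w' : euclid_hilbert R n := map_mx (real_complex R) w : 'rV_n.
move=> /(_ w'); rewrite !cfc_diag_op // lecE => /andP[_].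
rewrite -[X in X <= _ -> _]/(rinner _ w') -[X in _ <= X -> _]/(rinner _ w').
rewrite !rinner_diag_op_real // !mulmx1.
have -> : map_mx (@complex.Re R) (map_mx (real_complex R) w) = w.
  by apply/matrixP => i j; rewrite !mxE.
have -> : map_mx (@complex.Im R) (map_mx (real_complex R) w) = 0.
  by apply/matrixP => i j; rewrite !mxE.
have sum0 (c : 'I_n -> R) : \sum_j c j * (0 : 'rV[R]_n) 0 j ^+ 2 = 0.
  by apply: big1 => j _; rewrite mxE expr0n mulr0.
by rewrite mul0mx !sum0 !addr0.
Qed.

(** The space of polynomials of degree less than $n$ with inner product
   $\sum_i a_i p(x_i) q(x_i) = \sum_j b_j p(y_j) q(y_j)$. Multiplication by the
   variable, reduced modulo the node polynomial of the $x_i$ or of the $y_j$, is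
   a self-adjoint operator with these eigenvalues, and the difference of the two
   operators is a nonnegative form of rank one. The orthogonal matrix relates
   the two bases of interpolation polynomials. *)
Lemma operator_monotone_quadrature f (x y a b : 'I_n -> R) (q : {poly R}) :
  operator_monotone `]0, +oo[ f -> injective x ->
  (forall i, 0 < x i) -> (forall j, 0 < y j) ->
  (forall i, 0 < a i) -> (forall j, 0 < b j) ->
  (forall p : {poly R}, (size p <= n.*2)%N ->
     \sum_j b j * p.[y j] - \sum_i a i * p.[x i] = p`_(n.*2).-1) ->
  (size q <= n)%N ->
  \sum_i a i * (f (x i) * q.[x i] ^+ 2) <= \sum_j b j * (f (y j) * q.[y j] ^+ 2).
Proof.
move=> fmono xinj x0 y0 a0 b0 quad qn.
pose xs := [seq x i | i <- enum 'I_n].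
have uxs : uniq xs by rewrite map_inj_uniq ?enum_uniq.
have xsx i : x i \in xs by apply/mapP; exists i => //; rewrite mem_enum.
have sxs : size xs = n by rewrite size_map size_enum_ord.
pose l i := newton_interp (fun t => (t == x i)%:R) xs.
have lx i k : (l i).[x k] = (i == k)%:R.
  by rewrite newton_interpE // (inj_eq xinj) eq_sym.
have sl i : (size (l i) <= n)%N by rewrite -sxs size_newton_interp.
have interp (p : {poly R}) : (size p <= n)%N -> p = \sum_i p.[x i] *: l i.
  move=> pn; apply/eqP; rewrite -subr_eq0; apply/eqP.
  apply: (@roots_geq_poly_eq0 _ _ xs) => //; last first.
    rewrite sxs (leq_trans (size_polyD _ _)) // geq_max pn size_polyN.
    apply: (leq_trans (size_sum _ _ _)); apply/bigmax_leqP => i _.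
    exact: (leq_trans (size_scale_leq _ _)).
  apply/allP => _ /mapP[k _ ->]; rewrite rootE !hornerE horner_sum.
  rewrite (bigD1 k) //= big1 ?addr0 => [|i ik]; last by rewrite hornerZ lx (negbTE ik) mulr0.
  by rewrite hornerZ lx eqxx mulr1 subrr.
(* The rows $\sqrt{a_i} p(x_i)$ and $\sqrt{b_j} p(y_j)$ are the coordinates of
   [p] in the two orthonormal bases. *)
pose V : 'M[R]_n := \matrix_(i, j) (Num.sqrt (b j) / Num.sqrt (a i) * (l i).[y j]).
have sa i : Num.sqrt (a i) != 0 by rewrite sqrtr_eq0 -ltNge.
have transport (p : {poly R}) : (size p <= n)%N ->
    (\row_i (Num.sqrt (a i) * p.[x i])) *m V = \row_j (Num.sqrt (b j) * p.[y j]).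
  move=> pn; apply/rowP => j; rewrite !mxE {2}(interp p pn) horner_sum mulr_sumr.
  apply: eq_bigr => i _; rewrite !mxE hornerZ.
  by rewrite -[RHS](mulfK (sa i)); ring.
have quad0 (p : {poly R}) : (size p < n.*2)%N -> \sum_j b j * p.[y j] = \sum_i a i * p.[x i].
  move=> pn; apply/eqP; rewrite -subr_eq0 quad ?(ltnW pn) // nth_default //.
  by rewrite -ltnS prednK // (leq_ltn_trans _ pn).
have VV : V *m V^T = 1%:M.
  apply/matrixP => i k; rewrite !mxE.
  transitivity (((Num.sqrt (a i))^-1 * (Num.sqrt (a k))^-1) * \sum_j b j * (l i * l k).[y j]).
    rewrite mulr_sumr; apply: eq_bigr => j _; rewrite !mxE hornerM.
    by rewrite -[b j in RHS]sqr_sqrtr ?(ltW (b0 j)) //; ring.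
  rewrite quad0; last first.
    have n0 : (0 < n)%N by exact: leq_ltn_trans (leq0n i) (ltn_ord i).
    apply: (leq_ltn_trans (size_polyMleq _ _)); rewrite -addnn.
    apply: (@leq_ltn_trans (n + n).-1); last by rewrite prednK // addn_gt0 n0.
    by rewrite -!subn1 leq_sub2r // leq_add.
  rewrite (bigD1 i) //= big1 => [|j ji]; last by rewrite hornerM lx eq_sym (negbTE ji) mul0r mulr0.
  rewrite addr0 hornerM !lx eqxx mul1r eq_sym; case: eqP => [->|_]; last by rewrite !mulr0.
  by rewrite mulr1 -invfM -expr2 sqr_sqrtr ?(ltW (a0 k)) // mulVf ?gt_eqF.
have := @operator_monotone_quadratic f V x y (\row_i (Num.sqrt (a i) * q.[x i])) fmono VV x0 y0.
have sq (c : 'I_n -> R) (g h : 'I_n -> R) : (forall i, 0 < c i) ->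
    \sum_i g i * (\row_i (Num.sqrt (c i) * h i)) 0 i ^+ 2 = \sum_i c i * (g i * h i ^+ 2).
  move=> c0; apply: eq_bigr => i _; rewrite mxE exprMn sqr_sqrtr ?(ltW (c0 i)) //; ring.
rewrite transport // !sq //; apply=> u.
pose p : {poly R} := \sum_i (u 0 i / Num.sqrt (a i)) *: l i.
have pn : (size p <= n)%N.
  apply: (leq_trans (size_sum _ _ _)); apply/bigmax_leqP => i _.
  exact: (leq_trans (size_scale_leq _ _)).
have uE : u = \row_i (Num.sqrt (a i) * p.[x i]).
  apply/rowP => i; rewrite mxE /p horner_sum (bigD1 i) //= big1 => [|k ki].
    by rewrite hornerZ lx eqxx addr0 mulr1 mulrCA mulfV ?mulr1.
  by rewrite hornerZ lx (negbTE ki) mulr0.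
rewrite uE transport // !sq // -subr_ge0.
(* The difference of the two forms at [p] is the coefficient of degree
   $2n - 1$ of $X p^2$: zero, or the square of the leading one of [p]. *)
pose r : {poly R} := 'X * p ^+ 2.
have sp : (size r <= n.*2)%N.
  rewrite /r; have [->|p0] := eqVneq p 0; first by rewrite expr0n mulr0 size_poly0.
  rewrite mulrC size_mulX ?expf_neq0 // expr2 size_mul //.
  by rewrite prednK ?addn_gt0 ?size_poly_gt0 ?p0 // -addnn leq_add.
have := quad _ sp; under eq_bigr do rewrite hornerM hornerX horner_exp.
under [X in _ - X]eq_bigr do rewrite hornerM hornerX horner_exp.
move=> ->; have [sE|sN] := eqVneq (size r) n.*2.
  by rewrite -sE -lead_coefE lead_coefM lead_coefX mul1r lead_coef_exp sqr_ge0.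
have rn : (size r < n.*2)%N by rewrite ltn_neqAle sN.
by rewrite nth_default // -ltnS prednK // (leq_ltn_trans _ rn).
Qed.

End QuadraticFormComparison.

(** * Signs of the divided differences of an operator monotone function *)

Section SignsOfDividedDifferences.
Variable R : realType.
Implicit Types (f : R -> R) (s : seq R) (z : R) (q : {poly R}).

Lemma big_ord_double n (F : nat -> R) :
  \sum_(i < n.*2) F i = \sum_(i < n) F i.*2.+1 + \sum_(i < n) F i.*2.
Proof.
elim: n => [|n IH]; first by rewrite !big_ord0 addr0.
by rewrite doubleS !big_ord_recr IH /=; ring.
Qed.

(** Each factor is negative exactly when [w] lies below [z]. *)
Lemma sign_prod_sub s z :
  0 < (-1) ^+ count (< z) s * \prod_(w <- s | w != z) (w - z).
Proof.
elim: s => [|w s IH]; first by rewrite big_nil mulr1.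
rewrite big_cons /=; case: (ltgtP w z) => wz /=.
- by rewrite add1n exprS mulrACA mulr_gt0 // mulN1r opprB subr_gt0.
- by rewrite add0n mulrCA mulr_gt0 // subr_gt0.
- by rewrite add0n.
Qed.

Lemma sign_node_prod s i : sorted <%R s -> (i < size s)%N -> ~~ odd (size s) ->
  0 < (-1) ^+ i.+1 * \prod_(w <- s | w != s`_i) (s`_i - w).
Proof.
move=> ss si se; have us := lt_sorted_uniq ss.
have opp z r : \prod_(w <- r | w != z) (z - w) =
    (-1) ^+ count (predC1 z) r * \prod_(w <- r | w != z) (w - z).
  elim: r => [|w r IH]; first by rewrite !big_nil mulr1.
  rewrite !big_cons IH /=; case: eqP => //= _.
  by rewrite add1n exprS mulrACA mulN1r opprB.
have -> : \prod_(w <- s | w != s`_i) (s`_i - w) = - \prod_(w <- s | w != s`_i) (w - s`_i).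
  rewrite opp; transitivity (-1 * \prod_(w <- s | w != s`_i) (w - s`_i)); last by rewrite mulN1r.
  congr (_ * _); rewrite -signr_odd.
  have := count_predC (pred1 s`_i) s; rewrite count_uniq_mem // mem_nth //= add1n.
  by move=> sE; move: se; rewrite -sE /= negbK => ->; rewrite expr1.
by rewrite exprS mulN1r mulrNN -[X in _ ^+ X](count_lt_nth 0 ss si) sign_prod_sub.
Qed.

(** The weights of a divided difference alternate in sign along the sorted nodes:
   those of the nodes with even index are negative and, up to sign, the $a_i$,
   those of the others are the $b_j$. The quadrature hypothesis is then the value
   of divided differences on polynomials. *)
Lemma operator_monotone_divdiff_sqr f n s q : operator_monotone `]0, +oo[ f ->
  sorted <%R s -> all (> 0) s -> size s = n.*2 -> (size q <= n)%N ->
  0 <= divdiff (fun t => f t * q.[t] ^+ 2) s.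
Proof.
move=> fmono ss s0 sn qn; have us := lt_sorted_uniq ss.
have se : ~~ odd (size s) by rewrite sn odd_double.
pose wt z := (\prod_(w <- s | w != z) (z - w))^-1.
pose x (i : 'I_n) := s`_i.*2; pose y (i : 'I_n) := s`_i.*2.+1.
have xs (i : 'I_n) : (i.*2 < size s)%N by rewrite sn ltn_double.
have ys (i : 'I_n) : (i.*2.+1 < size s)%N by rewrite sn ltn_Sdouble.
have DE g : divdiff g s = \sum_i wt (y i) * g (y i) - \sum_i - wt (x i) * g (x i).
  rewrite /divdiff (big_nth 0) big_mkord sn.
  rewrite (big_ord_double n (fun i => g s`_i / \prod_(w <- s | w != s`_i) (s`_i - w))).
  rewrite -sumrN; congr (_ + _); apply: eq_bigr => i _; first by rewrite mulrC.
  by rewrite mulNr opprK mulrC.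
rewrite DE subr_ge0; apply: operator_monotone_quadrature => //.
- move=> i j /eqP; rewrite nth_uniq // => /eqP ij; apply: val_inj.
  exact: double_inj ij.
- by move=> i; apply: (allP s0); exact: mem_nth.
- by move=> i; apply: (allP s0); exact: mem_nth.
- move=> i; rewrite -invrN invr_gt0.
  by have := sign_node_prod ss (xs i) se; rewrite exprS -signr_odd odd_double mulr1 mulN1r.
- move=> i; rewrite invr_gt0.
  by have := sign_node_prod ss (ys i) se; rewrite -signr_odd /= odd_double expr0 mul1r.
- by move=> p pn; rewrite -(DE (horner p)) divdiff_horner ?sn.
Qed.

(** An even number of nodes is covered by $q = 1$. For an odd number a further
   node $z$ is added at which $q = X - z$ vanishes: the divided difference of
   $f(t)(t - z)$ is nonnegative, and $z \to +\infty$ gives the sign for $f$. *)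
Lemma operator_monotone_alternating f : operator_monotone `]0, +oo[ f ->
  alternating 1 f.
Proof.
move=> fmono.
have sqr n s q : uniq s -> all (> 0) s -> size s = n.*2 -> (size q <= n)%N ->
    0 <= divdiff (fun t => f t * q.[t] ^+ 2) s.
  move=> us s0 sn qn; have /permPl/perm_divdiff <- := perm_sort <=%R s.
  apply: (operator_monotone_divdiff_sqr (n := n)) => //.
  - by rewrite lt_sorted_uniq_le sort_uniq us sort_le_sorted.
  - by rewrite all_sort.
  - by rewrite size_sort.
move=> s us s0 s1; have := odd_double_half (size s).
case os: (odd (size s)); rewrite ?add0n ?add1n => sE.
  have n1 : (1 < (size s)./2.+1)%N by case: (_./2) sE s1 => [<-|].
  rewrite -signr_odd os expr1 mulN1r oppr_ge0 leNgt; apply/negP => Ds.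
  (* Beyond all nodes, and so large that [z * divdiff f s] exceeds the divided
     difference of $t f(t)$. *)
  pose z := 1 + \sum_(w <- s) w + `|divdiff (fun t => t * f t) s| / divdiff f s.
  have zs w : w \in s -> w < z.
    move=> ws; have : w <= \sum_(w <- s) w.
      rewrite (big_rem w) //= lerDl big_seq sumr_ge0 // => v /mem_rem vs.
      by rewrite ltW //; exact: (allP s0).
    by have : 0 <= `|divdiff (fun t => t * f t) s| / divdiff f s by [rewrite divr_ge0 // ltW]; rewrite /z; lra.
  have nz : z \notin s by apply/negP => /zs; rewrite ltxx.
  have z0 : 0 < z.
    case: (s) s1 s0 zs => // w r _ /= /andP[w0 _] zs.
    by apply: (lt_trans w0); apply: zs; rewrite inE eqxx.
  have szs : size (z :: s) = (size s)./2.+1.*2 by rewrite /= doubleS sE.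
  have := @sqr _ (z :: s) ('X - z%:P) _ _ szs; rewrite size_XsubC /= nz us z0 s0.
  move=> /(_ isT isT n1).
  rewrite (@eq_divdiff _ _ (fun t => (t - z) * (t * f t - z * f t))); last first.
    by move=> t _; rewrite hornerXsubC; ring.
  rewrite divdiff_mul_root // divdiffB divdiffZ subr_ge0 leNgt => /negP; apply.
  apply: (le_lt_trans (ler_norm _)); rewrite -ltr_pdivrMr // /z ltrDr.
  by rewrite ltr_wpDr // big_seq sumr_ge0 // => v vs; rewrite ltW //; exact: (allP s0).
rewrite -signr_odd os expr0 mul1r.
have := @sqr (size s)./2 s 1 us s0 (esym sE); rewrite size_poly1.
rewrite (@eq_divdiff _ _ f); last by move=> t _; rewrite hornerC expr1n mulr1.
by apply; rewrite half_gt0.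
Qed.

End SignsOfDividedDifferences.

(** * The norm of a derivative of an operator monotone function *)

Section NormOfDerivatives.
Variables (R : realType) (H : hilbertSpace R).
Implicit Types (A B : H -> H) (f g : R -> R).

(** The number is the least approximate eigenvalue of [A]. That the functional
   calculus is defined at the derivative is part of the claim, since [cfc] is zero
   otherwise. *)
Lemma opnorm_cfc_ge A f n : alternating 1 f -> (0 < n)%N -> positive_definite A ->
  (exists x : H, rnorm x != 0) ->
  exists a, [/\ 0 < a, forall x, a * rnorm x ^+ 2 <= rinner (A x) x &
    `|f^`(n)%classic a| <= opnorm (cfc f^`(n)%classic A)].
Proof.
move=> fa n0 [Ab As _ Asp] nz.
have [a [Aa Ale]] := approx_eigenvalue_min Ab As nz.
have a0 : 0 < a.
  have [t] := Asp _ (approx_eigenvalue_spectrum Aa).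
  by rewrite /= in_itv /= andbT => t0 [<-].
exists a; split=> //.
have [M M0 AM] := bounded_rnorm Ab.
have AM2 x : rinner (A x) x <= M * rnorm x ^+ 2.
  by apply: (le_trans (rinner_le _ _)); rewrite expr2 mulrA ler_wpM2r ?rnorm_ge0.
have [p pE] := alternating_poly_approx M (alternating_derive1n fa n0) a0.
have [|T Tg] := @is_cfc_exists _ _ A f^`(n)%classic a M (fun k => (-1) ^+ n *: p k) Ab As Ale AM2.
  move=> e e0; have [N hN] := pE e e0; exists N => k t Nk at1 tM.
  have -> : f^`(n)%classic t - ((-1) ^+ n *: p k).[t] =
      (-1) ^+ n * ((-1) ^+ n * f^`(n)%classic t - (p k).[t]).
    by rewrite hornerZ mulrBr mulrA -expr2 sqrr_sign mul1r.
  by rewrite normrM normrX normrN1 expr1n mul1r; exact: hN.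
apply: (is_cfc_opnorm_ge Ab) Aa.
by rewrite /cfc; case: xgetP => [_ -> //|/(_ T)].
Qed.

Lemma opnorm_cfc_le A g a : bounded_operator A -> self_adjoint A -> 0 < a ->
  (forall x, a * rnorm x ^+ 2 <= rinner (A x) x) ->
  (forall t, a <= t -> `|g t| <= `|g a|) -> opnorm (cfc g A) <= `|g a|.
Proof.
move=> Ab As a0 Aa ga; rewrite /cfc; case: xgetP => [T -> Tg|_].
  apply: (is_cfc_opnorm_le Ab As Tg) => // t At.
  exact: ga (approx_eigenvalue_ge Aa At).
by apply: opnorm_le => // x; rewrite rnorm0 mulr_ge0 ?rnorm_ge0.
Qed.

Lemma bounded_operator_comb A B (a b : R) : bounded_operator A -> bounded_operator B ->
  bounded_operator (a%:C *: A + b%:C *: B).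
Proof.
move=> Ab Bb; have Al := bounded_linear Ab; have Bl := bounded_linear Bb.
have [K K0 AK] := bounded_rnorm Ab; have [L L0 BL] := bounded_rnorm Bb.
apply: (@bounded_operatorP _ _ _ (`|a| * K + `|b| * L)) => [z x y|x].
  transitivity (a%:C *: A (z *: x + y) + b%:C *: B (z *: x + y)) => //.
  rewrite (Al z x y) (Bl z x y) !scalerDr !scalerA [a%:C * z]mulrC [b%:C * z]mulrC.
  by rewrite -!scalerA addrACA -scalerDr.
rewrite mulrDl; apply: (le_trans (rnormD _ _)).
by rewrite !rnormZr -!mulrA lerD // ler_wpM2l.
Qed.

Lemma rinner_comb_ge A B (a b m nu : R) (x : H) : 0 <= nu -> nu <= 1 -> m <= a -> m <= b ->
  a * rnorm x ^+ 2 <= rinner (A x) x -> b * rnorm x ^+ 2 <= rinner (B x) x ->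
  m * rnorm x ^+ 2 <= rinner (((1 - nu)%:C *: A + nu%:C *: B) x) x.
Proof.
move=> nu0 nu1 ma mb Ax Bx.
rewrite -[rinner _ x]/(rinner ((1 - nu)%:C *: A x + nu%:C *: B x) x).
have x2 : 0 <= rnorm x ^+ 2 := sqr_ge0 _.
have mA := le_trans (ler_wpM2r x2 ma) Ax; have mB := le_trans (ler_wpM2r x2 mb) Bx.
have nu10 : 0 <= 1 - nu by rewrite subr_ge0.
have := ler_wpM2l nu10 mA; have := ler_wpM2l nu0 mB.
by rewrite rinnerDl !rinnerZl; lra.
Qed.

Lemma self_adjoint_comb A B (a b : R) : self_adjoint A -> self_adjoint B ->
  self_adjoint (a%:C *: A + b%:C *: B).
Proof.
move=> As Bs x y.
transitivity (inner H (a%:C *: A x + b%:C *: B x) y) => //.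
transitivity (inner H x (a%:C *: A y + b%:C *: B y)) => //.
rewrite linearDl linearDr; congr (_ + _); rewrite linearZl_LR linearZr_LR.
  by rewrite [X in _ * X]As; congr (_ * _); exact/esym/conj_real.
by rewrite [X in _ * X]Bs; congr (_ * _); exact/esym/conj_real.
Qed.

End NormOfDerivatives.

Theorem theorem1 (R : realType) (H : hilbertSpace R) (f : R -> R)
    (hf : operator_monotone `]0, +oo[ f) (n : nat) (hn : (0 < n)%N)
    (A B : H -> H) (hA : positive_definite A) (hB : positive_definite B)
    (nu : R) (hnu0 : 0 <= nu) (hnu1 : nu <= 1) :
  opnorm (cfc (f^`(n))%classic ((1 - nu)%:C *: A + nu%:C *: B)) <=
  Num.max (opnorm (cfc (f^`(n))%classic A)) (opnorm (cfc (f^`(n))%classic B)).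
Proof.
have fa := operator_monotone_alternating hf.
have [nz|/forallNP nz] := pselect (exists x : H, rnorm x != 0); last first.
  have r0 (x : H) : rnorm x = 0 by apply/eqP; have /negP := nz x; rewrite negbK.
  have max0 (x y : R) : 0 <= x -> 0 <= Num.max x y by move=> x0; rewrite le_max x0.
  apply: opnorm_le => [|x]; first exact: max0 (opnorm_ge0 _).
  by rewrite !r0 mulr0.
have [a [a0 Aa gA]] := opnorm_cfc_ge fa hn hA nz.
have [b [b0 Bb gB]] := opnorm_cfc_ge fa hn hB nz.
have [[Abd As _ _] [Bbd Bs _ _]] := (hA, hB).
have le_m m : 0 < m -> m <= a -> m <= b ->
    opnorm (cfc f^`(n)%classic ((1 - nu)%:C *: A + nu%:C *: B)) <= `|f^`(n)%classic m|.
  move=> m0 ma mb; apply: opnorm_cfc_le => //.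
  - exact: bounded_operator_comb.
  - exact: self_adjoint_comb.
  - by move=> x; apply: (rinner_comb_ge hnu0 hnu1 ma mb (Aa x) (Bb x)).
  - by move=> t; exact: alternating_norm_derive1n_le.
have [ab|/ltW ba] := leP a b.
  have hm := le_m a a0 (lexx a) ab; move: hm gA; move: (opnorm _) (opnorm _) (opnorm _).
  by move=> c u v cg gu; rewrite le_max (le_trans cg gu).
have hm := le_m b b0 ba (lexx b); move: hm gB; move: (opnorm _) (opnorm _) (opnorm _).
by move=> c u v cg gv; rewrite le_max (le_trans cg gv) orbT.
Qed.
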